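(* Let $\Bbbk$ be a field of any characteristic, let $n\geq 1$ be an integer, and let $X=(x_{ij})_{1\le i,j\le n}$ and $Y=(y_{ij})_{1\le i,j\le n}$ be $n\times n$ matrices of indeterminates over $\Bbbk$. Let $C=XY-YX=(c_{ij})_{1\le i,j\le n}$ be their commutator matrix. In the polynomial ring $\Bbbk[X,Y]$ in the $2n^2$ indeterminates $x_{ij},y_{ij}$, let $\mathfrak{a}$ be the ideal generated by the anti-diagonal entries of $C$, and let $\mathfrak{c}$ be the ideal generated by the cross-diagonal entries of $C$, that is, by the diagonal entries together with the anti-diagonal entries of $C$. Then the ideal $\mathfrak{c}$ is prime for each $n$, while the ideal $\mathfrak{a}$ is prime exactly when $n\neq 2$.
   Context: The diagonal entries of $C$ are $c_{ii}$ and the anti-diagonal entries are $c_{i,n+1-i}$, for $1\le i\le n$. *)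

(* Defs.v *)
From HB Require Import structures.
From mathcomp Require Import all_boot all_order all_algebra.
From mathcomp Require Import boolp mpoly.

Set Implicit Arguments.
Unset Strict Implicit.
Unset Printing Implicit Defensive.

Import GRing.Theory.

Local Open Scope ring_scope.

(* Membership is not decidable in general; the coercion to a boolean predicate
   by `[< _ >] is what lets the ideal predicates of ring_quotient apply. *)
Definition ideal_gen (R : comNzRingType) (s : seq R) : {pred R} :=
  fun p => `[< exists a : 'I_(size s) -> R, p = \sum_i a i * s`_i >].

(* [idealr_closed] includes that 1 is not a member. *)
Definition prime_ideal (R : comNzRingType) (I : {pred R}) : Prop :=
  idealr_closed I /\ prime_idealr_closed I.

(* k[X, Y]: the first n * n variables are the x_ij, the last n * n the y_ij,
   each block being indexed through [mxvec_index]. *)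
Definition kXY (k : fieldType) (n : nat) := {mpoly k[n * n + n * n]}.

Definition Xmx (k : fieldType) (n : nat) : 'M[kXY k n]_n :=
  \matrix_(i, j) 'X_(lshift (n * n) (mxvec_index i j)).

Definition Ymx (k : fieldType) (n : nat) : 'M[kXY k n]_n :=
  \matrix_(i, j) 'X_(rshift (n * n) (mxvec_index i j)).

Definition Cmx (k : fieldType) (n : nat) : 'M[kXY k n]_n :=
  Xmx k n *m Ymx k n - Ymx k n *m Xmx k n.

Definition diag_entries (R : Type) (n : nat) (A : 'M[R]_n) : seq R :=
  [seq A i i | i : 'I_n].

(* With indices starting at 0, [rev_ord i] is n - 1 - i. *)
Definition antidiag_entries (R : Type) (n : nat) (A : 'M[R]_n) : seq R :=
  [seq A i (rev_ord i) | i : 'I_n].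

Definition ideal_a (k : fieldType) (n : nat) : {pred kXY k n} :=
  ideal_gen (antidiag_entries (Cmx k n)).

Definition ideal_c (k : fieldType) (n : nat) : {pred kXY k n} :=
  ideal_gen (diag_entries (Cmx k n) ++ antidiag_entries (Cmx k n)).

Arguments ideal_a : clear implicits.
Arguments ideal_c : clear implicits.

(* Main.v *)
(* Write z_ij = (x_ij, y_ij), i' = n + 1 - i, and [u, v] for the determinant of two
   vectors of length 2, so that c_ij = \sum_h [z_ih, z_hj]. Let n >= 3.
   For a suitable weighted monomial order, the leading monomials of the generators
   (all diagonal entries but one, and the anti-diagonal entries) are pairwise
   coprime, and also coprime to the leading monomial of each determinant
   [z_ii', z_i'i] and of certain variables; these are therefore non-zero-divisors
   modulo the ideal. Inverting them, one solves the diagonal entries for one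
   off-diagonal variable each, and the pair of entries (i, i'), (i', i) for
   z_ii - z_i'i' by Cramer's rule. So modulo the ideal every polynomial becomes,
   up to a non-zero-divisor, a polynomial in the remaining variables; and no nonzero
   polynomial in these lies in the ideal, because for a second monomial order the
   leading monomials of the generators are again pairwise coprime, and each of them
   involves an eliminated variable. Hence the ideal is prime.
   For n = 2 the entries are, up to sign, the 2 x 2 minors of the matrix with columns
   z_12, z_11 - z_22, z_21; two of them do not generate a prime ideal, and for the
   three of them the non-zero-divisors are found by hand. *)

From HB Require Import structures.
Require Import Defs.
From mathcomp Require Import all_boot all_order all_algebra.
From mathcomp Require Import boolp mpoly ring zify.
Set Implicit Arguments.
Unset Strict Implicit.
Unset Printing Implicit Defensive.
Import Order.TTheory GRing.Theory.
Local Open Scope ring_scope.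

(** * Ideals spanned by a family *)

Section IdealSpan.
Variables (R : comNzRingType) (L : eqType).
Implicit Types (l : seq L) (g : L -> R) (p q : R).

(** Coefficients are indexed by labels, so a label repeated in [l] would receive a single
    coefficient for all its occurrences; hence the [uniq] conditions on families of generators. *)
Definition span l g p := exists a : L -> R, p = \sum_(e <- l) a e * g e.

Lemma span0 l g : span l g 0.
Proof. by exists (fun=> 0); rewrite big1 // => e _; rewrite mul0r. Qed.

Lemma spanD l g p q : span l g p -> span l g q -> span l g (p + q).
Proof.
move=> [a ->] [b ->]; exists (fun e => a e + b e).
by rewrite -big_split /=; apply: eq_bigr => e _; rewrite mulrDl.
Qed.

Lemma spanM l g p q : span l g q -> span l g (p * q).
Proof.
move=> [a ->]; exists (fun e => p * a e).
by rewrite mulr_sumr; apply: eq_bigr => e _; rewrite mulrA.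
Qed.

Lemma spanN l g p : span l g p -> span l g (- p).
Proof. by rewrite -mulN1r; apply: spanM. Qed.

Lemma spanB l g p q : span l g p -> span l g q -> span l g (p - q).
Proof. by move=> hp hq; apply/spanD/spanN. Qed.

Lemma span_sum l g (J : Type) (s : seq J) (P : pred J) F :
  (forall j, P j -> span l g (F j)) -> span l g (\sum_(j <- s | P j) F j).
Proof. by move=> h; elim/big_rec: _ => [|j p Pj]; [apply: span0|apply/spanD/h]. Qed.

Lemma span_nil g p : span [::] g p -> p = 0.
Proof. by case=> a ->; rewrite big_nil. Qed.

Lemma span_cons e l g p : span (e :: l) g p -> exists a, span l g (p - a * g e).
Proof. by case=> a ->; exists (a e), a; rewrite big_cons addrC addKr. Qed.

Lemma span_gen l g e : uniq l -> e \in l -> span l g (g e).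
Proof.
move=> ul el; exists (fun x => (x == e)%:R).
rewrite (bigD1_seq e) //= eqxx mul1r big1 ?addr0 // => x /negbTE->.
by rewrite mul0r.
Qed.

Definition nzd l g h := forall p, span l g (h * p) -> span l g p.

Lemma nzdM l g h h' : nzd l g h -> nzd l g h' -> nzd l g (h * h').
Proof. by move=> H H' p; rewrite -mulrA => /H/H'. Qed.

Lemma nzd1 l g : nzd l g 1.
Proof. by move=> p; rewrite mul1r. Qed.

Lemma nzd_congr l g h h' : span l g (h - h') -> nzd l g h -> nzd l g h'.
Proof.
move=> hh H p hp; apply: H; rewrite -[h](subrK h') mulrDl.
by apply: spanD hp; rewrite mulrC; apply: spanM.
Qed.
End IdealSpan.

(** * Coprime leading monomials *)

Lemma mpolyX_neq0 (k : fieldType) N (i : 'I_N) : 'X_i != 0 :> {mpoly k[N]}.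
Proof. by rewrite -msupp_eq0 msuppX. Qed.

Section WeightedLead.
Variables (k : fieldType) (N : nat) (w : 'I_N -> nat).
Hypothesis w_gt0 : forall i, (0 < w i)%N.
Local Notation R := {mpoly k[N]}.
Implicit Types (p q : R) (m : 'X_{1..N}).

Definition dilm m : 'X_{1..N} := [multinom (w i * m i)%N | i < N].

Definition undilm m : 'X_{1..N} := [multinom (m i %/ w i)%N | i < N].

Lemma dilmK : cancel dilm undilm.
Proof. by move=> m; apply/mnmP => i; rewrite !mnmE mulKn. Qed.

Lemma dilmD m1 m2 : dilm (m1 + m2) = (dilm m1 + dilm m2)%MM.
Proof. by apply/mnmP => i; rewrite !mnmE mulnDr. Qed.

(* Substituting 'X_i ^+ w i for 'X_i turns the weighted degree into the degree,
   so that [mlead] computes leading monomials for the weighted order. *)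
Definition dil : R -> R := mmap (@mpolyC N k) (fun i => 'X_i ^+ w i).
HB.instance Definition _ := GRing.RMorphism.on dil.

Lemma dilX m : dil 'X_[m] = 'X_[dilm m].
Proof.
rewrite /dil mmapX /mmap1 mpolyXE_id; apply: eq_bigr => i _.
by rewrite mnmE exprM.
Qed.

Lemma dilZ c p : dil (c *: p) = c *: dil p.
Proof. by rewrite /dil mmapZ mul_mpolyC. Qed.

Lemma dilE p : dil p = \sum_(m <- msupp p) p@_m *: 'X_[dilm m].
Proof.
rewrite {1}[p]mpolyE rmorph_sum; apply: eq_bigr => m _ /=.
by rewrite dilZ dilX.
Qed.

Lemma mcoeff_dil p m : (dil p)@_(dilm m) = p@_m.
Proof.
rewrite dilE [in RHS](mpolyE p) !raddf_sum /=; apply: eq_bigr => m1 _.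
by rewrite !mcoeffZ !mcoeffX (can_eq dilmK).
Qed.

Lemma msupp_dil p m : m \in msupp (dil p) -> exists2 m', m' \in msupp p & m = dilm m'.
Proof.
rewrite dilE => /msupp_sum_le /flattenP /=.
case=> s /mapP[m']; rewrite filter_predT => m'p ->.
by move=> /msuppZ_le; rewrite msuppX inE => /eqP->; exists m'.
Qed.

Lemma dil_eq0 p : (dil p == 0) = (p == 0).
Proof.
apply/eqP/eqP => [p0|->]; last exact: raddf0.
by apply/mpolyP => m; rewrite -mcoeff_dil p0 !mcoeff0.
Qed.

(** The leading exponent for the order that compares weighted degrees first, read off after
    dilation; for [p = 0] it is 0 by default. *)
Definition lm p := undilm (mlead (dil p)).

Lemma mlead_dil p : p != 0 -> mlead (dil p) = dilm (lm p).
Proof.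
rewrite -dil_eq0 => /mlead_supp/msupp_dil[m _ E].
by rewrite /lm E dilmK.
Qed.

Lemma lm_supp p : p != 0 -> lm p \in msupp p.
Proof.
move=> p0; rewrite mcoeff_msupp -mcoeff_dil -mlead_dil // mleadc_eq0.
by rewrite dil_eq0.
Qed.

Lemma lmX i : lm ('X_i : R) = U_(i)%MM.
Proof. by rewrite /lm dilX mleadXm dilmK. Qed.

Lemma lmM p q : p != 0 -> q != 0 -> lm (p * q) = (lm p + lm q)%MM.
Proof.
move=> p0 q0; rewrite {1}/lm rmorphM mleadM ?dil_eq0 // !mlead_dil // -dilmD.
exact: dilmK.
Qed.

Lemma lmN p : lm (- p) = lm p.
Proof. by rewrite /lm raddfN mleadN. Qed.

Lemma lmD p q : p != 0 -> q != 0 -> lm p != lm q ->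
  p + q != 0 /\ (lm (p + q) = lm p \/ lm (p + q) = lm q).
Proof.
move=> p0 q0 pq; have ne : mlead (dil p) != mlead (dil q).
  by rewrite !mlead_dil // (can_eq dilmK).
split.
  rewrite addr_eq0; apply: contraNneq pq => ->.
  by rewrite lmN.
rewrite /lm raddfD mleadD //.
by case: (leP (mlead (dil p)) (mlead (dil q))) => _; [right|left].
Qed.

(** One division step: the quotient of the leading terms cancels the coefficient at [lm p]. A zero
    remainder is listed apart because [mlead 0] is 0, which is not below the lead of a constant. *)
Lemma lm_reduce p q : p != 0 -> q != 0 -> (lm q <= lm p)%MM ->
  exists c, p - c * q = 0 \/ (mlead (dil (p - c * q)) < mlead (dil p))%O.
Proof.
move=> p0 q0 le; pose m := (lm p - lm q)%MM.
pose a := p@_(lm p) / q@_(lm q); pose r := (a *: 'X_[m]) * q.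
have cp : p@_(lm p) != 0 by rewrite -mcoeff_msupp lm_supp.
have cq : q@_(lm q) != 0 by rewrite -mcoeff_msupp lm_supp.
have a0 : a != 0 by rewrite mulf_neq0 ?invr_eq0.
have X0 : a *: 'X_[m] != 0 :> R.
  by rewrite -msupp_eq0 msuppMCX.
have r0 : r != 0 by rewrite mulf_neq0.
have lmX : lm (a *: 'X_[m]) = m.
  by rewrite /lm dilZ dilX mleadZ ?mleadXm ?dilmK.
have lmr : lm r = lm p by rewrite lmM // lmX submK.
have cr : r@_(lm p) = p@_(lm p).
  rewrite -{1}(submK le) -/m /r mulrC -scalerAr mcoeffZ mcoeffMX.
  by rewrite /a divfK.
exists (a *: 'X_[m]); rewrite -/r.
have [->|d0] := eqVneq (p - r) 0; [by left|right].
rewrite lt_neqAle; apply/andP; split; last first.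
  rewrite raddfB; apply: (le_trans (mleadB_le _ _)).
  by rewrite !mlead_dil // lmr joinxx.
apply/eqP => E.
have : (p - r)@_(lm (p - r)) != 0 by rewrite -mcoeff_msupp lm_supp.
by rewrite /lm E -/(lm p) mcoeffB cr subrr eqxx.
Qed.

Lemma lm_ind (P : R -> Prop) :
  (forall p, (forall q, (mlead (dil q) < mlead (dil p))%O -> P q) -> P p) ->
  forall p, P p.
Proof.
move=> ih p; move: {2}(mlead (dil p)) (erefl (mlead (dil p))) => m.
elim/(ltmwf (n := N)): m p => m wih p E; apply: ih => q lt_q.
by apply: (wih (mlead (dil q))); rewrite -?E.
Qed.

Definition wdeg m := (\sum_i w i * m i)%N.

Lemma wdegE m : wdeg m = mdeg (dilm m).
Proof. by rewrite mdegE; apply: eq_bigr => i _; rewrite mnmE. Qed.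

Definition wless d p := forall m, m \in msupp p -> (wdeg m < d)%N.

(** [mlead] compares total degrees first, and dilation turns weighted degrees into total ones, so a
    term of strictly largest weighted degree leads without tie-breaking. *)
Lemma lm_eq c m p : c != 0 -> wless (wdeg m) p ->
  c *: 'X_[m] + p != 0 /\ lm (c *: 'X_[m] + p) = m.
Proof.
move=> c0 lt.
have cX0 : c *: 'X_[m] != 0 :> R by rewrite -msupp_eq0 msuppMCX.
have lX : mlead (dil (c *: 'X_[m])) = dilm m by rewrite dilZ dilX mleadZ ?mleadXm.
have lmX : lm (c *: 'X_[m]) = m by rewrite /lm lX dilmK.
have [->|p0] := eqVneq p 0; first by rewrite addr0.
have ltp : (mlead (dil p) < mlead (dil (c *: 'X_[m])))%O.
  rewrite lX mlead_dil //; apply: lt_mdeg_ltmc; rewrite -!wdegE.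
  exact/lt/lm_supp.
split; last by rewrite /lm raddfD mleadDl // lX dilmK.
rewrite addr_eq0; apply/eqP => E.
by move: ltp; rewrite E raddfN mleadN ltxx.
Qed.

(** * Division and ideal membership for generators with pairwise coprime leads *)

Section CoprimeLeads.
Variables (L : eqType) (g : L -> R) (mu : L -> 'X_{1..N}).

Definition coprime_leads (l : seq L) :=
  [/\ uniq l, forall e, e \in l -> g e != 0 /\ lm (g e) = mu e
    & forall e e', e \in l -> e' \in l -> e != e' ->
        forall v, mu e v = 0%N \/ mu e' v = 0%N].

Lemma coprime_leads_cons e l : coprime_leads (e :: l) -> coprime_leads l.
Proof.
case=> /andP[_ ul] hg hc; split=> // [x xl|x y xl yl].
  by apply: hg; rewrite inE xl orbT.
by apply: hc; rewrite inE ?xl ?yl orbT.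
Qed.

(** Only the leading monomial is constrained, which is weaker than a full normal form; 0 is exempt
    because its [lm] is a default value. *)
Definition reduced (l : seq L) p := p != 0 -> forall e, e \in l -> ~~ (mu e <= lm p)%MM.

Lemma reduce_mod l : coprime_leads l ->
  forall p, exists2 q, span l g (p - q) & reduced l q.
Proof.
move=> hl; apply: lm_ind => p ih.
have [p0|p0] := eqVneq p 0.
  by exists 0; [rewrite p0 subrr; apply: span0|rewrite /reduced eqxx].
case: (boolP (has (fun e => mu e <= lm p)%MM l)) => [/hasP[e el le]|/hasPn h]; last first.
  by exists p => [|_ e]; [rewrite subrr; apply: span0|apply: h].
have [ul hg _] := hl; have [ge0 lge] := hg e el.
rewrite -lge in le; have [c hc] := lm_reduce p0 ge0 le.
have sc : span l g (c * g e) by apply/spanM/span_gen.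
case: hc => [E|/ih[q hq rq]].
  exists 0; last by rewrite /reduced eqxx.
  by rewrite subr0 -[p](subrK (c * g e)) E add0r.
exists q => //.
have -> : p - q = (p - c * g e - q) + c * g e by ring.
exact: spanD.
Qed.

Lemma coprime_dvdm m1 m2 m : (forall v, m1 v = 0%N \/ m2 v = 0%N) ->
  (m1 <= m + m2)%MM -> (m1 <= m)%MM.
Proof.
move=> h /mnm_lepP le; apply/mnm_lepP => v; have := le v; rewrite mnmDE.
by case: (h v) => ->; rewrite ?addn0.
Qed.

(** Buchberger's coprimality criterion: such generators form a Gröbner basis. By induction on [l],
    the coefficient of the first generator is reduced modulo the others; its product with that
    generator then cannot share its leading monomial with the remaining part, so nothing cancels. *)
Lemma lm_span l p : coprime_leads l -> span l g p -> p != 0 ->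
  exists2 e, e \in l & (mu e <= lm p)%MM.
Proof.
elim: l p => [|e l ih] p hl; first by move=> /span_nil->; rewrite eqxx.
have hl' := coprime_leads_cons hl.
have [/andP[enl _] hg hc] := hl.
have [|ge0 lge] := hg e _; first exact: mem_head.
move=> /span_cons[a ha] p0; have [b hb rb] := reduce_mod hl' a.
pose q := p - b * g e.
have hq : span l g q.
  have -> : q = (p - a * g e) + g e * (a - b) by rewrite /q; ring.
  exact/spanD/spanM.
have pE : p = q + b * g e by rewrite /q subrK.
have [b0|b0] := eqVneq b 0.
  rewrite b0 mul0r addr0 in pE; rewrite -pE in hq.
  by have [x xl hx] := ih p hl' hq p0; exists x; rewrite ?inE ?xl ?orbT.
have bg0 : b * g e != 0 by rewrite mulf_neq0.
have lbg : lm (b * g e) = (lm b + mu e)%MM by rewrite lmM // lge.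
have dvd : (mu e <= lm (b * g e))%MM.
  by rewrite lbg; apply/mnm_lepP => v; rewrite mnmDE leq_addl.
have [q0|q0] := eqVneq q 0.
  by exists e; rewrite ?mem_head // pE q0 add0r.
have [x xl hx] := ih q hl' hq q0.
(* A common lead would be divisible by some [mu x]; being coprime to [mu e], it would divide [lm b],
   although [b] is reduced. *)
have ne : lm q != lm (b * g e).
  apply/eqP => E; move: hx; rewrite E lbg => /coprime_dvdm hx.
  have /negP := rb b0 x xl; apply; apply: hx; apply: hc.
  - by rewrite inE xl orbT.
  - exact: mem_head.
  - by apply: contraNneq enl => <-.
have [_ [E|E]] := lmD q0 bg0 ne; rewrite -pE in E; rewrite E.
  by exists x; rewrite // inE xl orbT.
by exists e; rewrite // mem_head.
Qed.

(** Replace [p] by a reduced [q]. If [q] were nonzero, some [mu e] would divide the lead of [q * h],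
    hence that of [q], by coprimality with [lm h]. *)
Lemma nzd_coprime_lead l h : coprime_leads l -> h != 0 ->
  (forall e, e \in l -> forall v, mu e v = 0%N \/ lm h v = 0%N) -> nzd l g h.
Proof.
move=> hl h0 hc p hp; have [q hq rq] := reduce_mod hl p.
have [q0|q0] := eqVneq q 0; first by rewrite q0 subr0 in hq.
have : span l g (q * h).
  have -> : q * h = h * p - h * (p - q) by ring.
  by apply/spanB/spanM.
case/(lm_span hl) => [|e el]; first by rewrite mulf_neq0.
by rewrite lmM // => /(coprime_dvdm (hc e el)); rewrite (negbTE (rq q0 e el)).
Qed.
End CoprimeLeads.
End WeightedLead.
(** * Elimination of variables *)

Section Elimination.
Variables (k : fieldType) (N : nat) (L : eqType).
Variables (l : seq L) (g : L -> {mpoly k[N]}) (V : pred 'I_N).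
Local Notation R := {mpoly k[N]}.
Implicit Types p q s d e : R.

Definition avoids p := forall m, m \in msupp p -> forall v, V v -> m v = 0%N.

Lemma avoidsC c : avoids c%:MP.
Proof.
move=> m; rewrite msuppC; case: ifP => // _; rewrite inE => /eqP-> v _.
by rewrite mnm0E.
Qed.

Lemma avoidsX i : ~~ V i -> avoids 'X_i.
Proof.
move=> Vi m; rewrite msuppX inE => /eqP-> v Vv; rewrite mnm1E.
by case: eqP => // E; rewrite -E (negbTE Vi) in Vv.
Qed.

Lemma avoidsD p q : avoids p -> avoids q -> avoids (p + q).
Proof. by move=> hp hq m /msuppD_le; rewrite mem_cat => /orP[/hp|/hq]. Qed.

Lemma avoidsM p q : avoids p -> avoids q -> avoids (p * q).
Proof.
move=> hp hq m /msuppM_le/allpairsP[[m1 m2] /= [m1p m2q ->]] v Vv.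
by rewrite mnmDE hp ?hq.
Qed.

(* The polynomials which become polynomials in the variables outside [V] modulo
   the ideal, once some non-zero-divisors are inverted. *)
Definition tame p := exists s P,
  [/\ nzd l g s, avoids s, avoids P & span l g (s * p - P)].

Lemma tame_avoids p : avoids p -> tame p.
Proof.
move=> hp; exists 1, p; split=> //; first exact: nzd1.
  by rewrite -mpolyC1; apply: avoidsC.
by rewrite mul1r subrr; apply: span0.
Qed.

Lemma tameX i : ~~ V i -> tame 'X_i.
Proof. by move=> Vi; apply/tame_avoids/avoidsX. Qed.

Lemma tameD p q : tame p -> tame q -> tame (p + q).
Proof.
move=> [s [P [ns as_ aP hP]]] [t [Q [nt at_ aQ hQ]]].
exists (s * t), (t * P + s * Q); split; first exact: nzdM.
- exact: avoidsM.
- by apply: avoidsD; apply: avoidsM.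
have -> : s * t * (p + q) - (t * P + s * Q)
  = t * (s * p - P) + s * (t * q - Q) by ring.
by apply: spanD; apply: spanM.
Qed.

Lemma tameM p q : tame p -> tame q -> tame (p * q).
Proof.
move=> [s [P [ns as_ aP hP]]] [t [Q [nt at_ aQ hQ]]].
exists (s * t), (P * Q); split; first exact: nzdM.
- exact: avoidsM.
- exact: avoidsM.
have -> : s * t * (p * q) - P * Q
  = t * q * (s * p - P) + P * (t * q - Q) by ring.
by apply: spanD; apply: spanM.
Qed.

Lemma tameN p : tame p -> tame (- p).
Proof.
rewrite -mulN1r => hp; apply: tameM => //; apply: tame_avoids.
by rewrite -mpolyC1 -mpolyCN; apply: avoidsC.
Qed.

Lemma tameB p q : tame p -> tame q -> tame (p - q).
Proof. by move=> hp hq; apply/tameD/tameN. Qed.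

Lemma tame0 : tame 0.
Proof. by apply: tame_avoids; rewrite -mpolyC0; apply: avoidsC. Qed.

Lemma tame_sum (J : Type) (r : seq J) (P : pred J) F :
  (forall j, P j -> tame (F j)) -> tame (\sum_(j <- r | P j) F j).
Proof. by move=> h; elim/big_rec: _ => [|j p Pj]; [apply: tame0|apply/tameD/h]. Qed.

(** Solves [d * p = e] modulo the ideal. The new denominator is [t * P], where [P] is congruent to
    [s * d] and therefore again a non-zero-divisor. *)
Lemma tame_div d e p :
  nzd l g d -> tame d -> tame e -> span l g (d * p - e) -> tame p.
Proof.
move=> nd [s [P [ns as_ aP hP]]] [t [Q [nt at_ aQ hQ]]] hp.
exists (t * P), (s * Q); split.
- apply: nzdM => //; apply: (@nzd_congr _ _ _ _ (s * d)); [exact: hP|exact: nzdM].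
- exact: avoidsM.
- exact: avoidsM.
have -> : t * P * p - s * Q =
  s * t * (d * p - e) + s * (t * e - Q) - t * p * (s * d - P) by ring.
by apply: spanB; [apply: spanD; apply: spanM|apply: spanM].
Qed.

Hypothesis tame_var : forall i, tame 'X_i.

Lemma tame_all p : tame p.
Proof.
elim/mpolyind: p => [|c m p _ _ hp]; first exact: tame0.
apply: tameD => //; rewrite -mul_mpolyC; apply: tameM.
  exact/tame_avoids/avoidsC.
rewrite mpolyXE_id; elim/big_rec: _ => [|i q _ hq].
  by apply: tame_avoids; rewrite -mpolyC1; apply: avoidsC.
apply: tameM => //; elim: (m i) => [|j hj].
  by apply: tame_avoids; rewrite expr0 -mpolyC1; apply: avoidsC.
by rewrite exprS; apply: tameM.
Qed.

Hypothesis span_avoids : forall p, avoids p -> span l g p -> p = 0.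

(** Clearing denominators moves the product among the polynomials avoiding [V]; there the ideal is
    zero, and the polynomial ring is a domain. *)
Lemma span_prime p q : span l g (p * q) -> span l g p \/ span l g q.
Proof.
move=> hpq.
have [s [P [ns as_ aP hP]]] := tame_all p.
have [t [Q [nt at_ aQ hQ]]] := tame_all q.
have : span l g (P * Q).
  have -> : P * Q = s * t * (p * q) - t * q * (s * p - P) - P * (t * q - Q)
    by ring.
  by apply: spanB; [apply: spanB|]; apply: spanM.
move/(span_avoids (avoidsM aP aQ))/eqP; rewrite mulf_eq0 => /orP[] /eqP E.
  by left; apply: ns; rewrite -[s * p]subr0 -E.
by right; apply: nt; rewrite -[t * q]subr0 -E.
Qed.

Lemma span_proper : ~ span l g 1.
Proof.
move/span_avoids => h; have /eqP := oner_eq0 R; rewrite h ?eqxx //.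
by rewrite -mpolyC1; apply: avoidsC.
Qed.

Lemma prime_ideal_span (I : {pred R}) :
  (forall p, p \in I <-> span l g p) -> prime_ideal I.
Proof.
move=> hI; split; first split.
- exact/hI/span0.
- by apply/negP => /hI/span_proper.
- by move=> a p q /hI hp /hI hq; apply/hI/spanD/hq/spanM.
by move=> p q /hI/span_prime[]/hI->; rewrite ?orbT.
Qed.

End Elimination.
(** * Leading monomials of the commutator entries *)

Section WeightedDegree.
Variables (k : fieldType) (N : nat) (w : 'I_N -> nat).

Lemma wdegD m1 m2 : wdeg w (m1 + m2)%MM = (wdeg w m1 + wdeg w m2)%N.
Proof. by rewrite -big_split; apply: eq_bigr => i _; rewrite mnmDE mulnDr. Qed.

Lemma wdegU i : wdeg w U_(i) = w i.
Proof.
rewrite /wdeg (bigD1 i) //= mnm1E eqxx muln1 big1 ?addn0 // => j /negbTE ne.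
by rewrite mnm1E eq_sym ne muln0.
Qed.

Lemma wless0 d : wless w d (0 : {mpoly k[N]}).
Proof. by move=> m; rewrite msupp0. Qed.

Lemma wlessD d (p q : {mpoly k[N]}) :
  wless w d p -> wless w d q -> wless w d (p + q).
Proof. by move=> hp hq m /msuppD_le; rewrite mem_cat => /orP[/hp|/hq]. Qed.

Lemma wlessZX d c m : (wdeg w m < d)%N -> wless w d (c *: 'X_[m] : {mpoly k[N]}).
Proof. by move=> h m' /msuppZ_le; rewrite msuppX inE => /eqP->. Qed.

Lemma wless_sum d (J : Type) (r : seq J) (P : pred J) (F : J -> {mpoly k[N]}) :
  (forall j, P j -> wless w d (F j)) -> wless w d (\sum_(j <- r | P j) F j).
Proof. by move=> h; elim/big_rec: _ => [|j p Pj]; [apply: wless0|apply/wlessD/h]. Qed.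
End WeightedDegree.

Section CommutatorLeads.
Variables (k : fieldType) (n : nat).
Local Notation cell := ('I_n * 'I_n)%type.
Implicit Types (i j : 'I_n) (a b : cell) (t : 'I_n * bool).

Definition vx a : 'I_(n * n + n * n) := lshift (n * n) (mxvec_index a.1 a.2).
Definition vy a : 'I_(n * n + n * n) := rshift (n * n) (mxvec_index a.1 a.2).

Lemma mxvec_index_inj a b : mxvec_index a.1 a.2 = mxvec_index b.1 b.2 -> a = b.
Proof. by move/cast_ord_inj/enum_rank_inj; case: a b => [? ?] [? ?]. Qed.

Lemma eq_vx a b : (vx a == vx b) = (a == b).
Proof. by apply/eqP/eqP => [/lshift_inj/mxvec_index_inj|->]. Qed.

Lemma eq_vy a b : (vy a == vy b) = (a == b).
Proof. by apply/eqP/eqP => [/rshift_inj/mxvec_index_inj|->]. Qed.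

Lemma eq_vxy a b : (vx a == vy b) = false.
Proof. by rewrite /vx /vy eq_lrshift. Qed.

Lemma eq_vyx a b : (vy a == vx b) = false.
Proof. by rewrite eq_sym eq_vxy. Qed.

Lemma var_ind (P : 'I_(n * n + n * n) -> Prop) :
  (forall a, P (vx a)) -> (forall a, P (vy a)) -> forall v, P v.
Proof.
move=> hx hy v; rewrite -[v]splitK; case: (split v) => u /=.
  by case/mxvec_indexP: u => i j; apply: (hx (i, j)).
by case/mxvec_indexP: u => i j; apply: (hy (i, j)).
Qed.

(** The [+ 1] makes all weights positive, as dilation requires; it shifts all the quadratic terms of
    an entry by the same amount. *)
Definition wt (wx wy : cell -> nat) (v : 'I_(n * n + n * n)) : nat :=
  (row_mx (mxvec (\matrix_(i, j) wx (i, j))) (mxvec (\matrix_(i, j) wy (i, j))))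
    ord0 v + 1.

(** A pair [t = (h, b)] names a term of the entry (i, j): x_ih y_hj if [b] holds, and x_hj y_ih,
    which has sign -1, otherwise. *)
Definition xcell i j t : cell := if t.2 then (i, t.1) else (t.1, j).
Definition ycell i j t : cell := if t.2 then (t.1, j) else (i, t.1).

Definition cmon a b : 'X_{1..n * n + n * n} := (U_(vx a) + U_(vy b))%MM.

Lemma cmon_disjoint a b a' b' : a != a' -> b != b' ->
  forall v, cmon a b v = 0%N \/ cmon a' b' v = 0%N.
Proof.
move=> /negbTE na /negbTE nb; apply: var_ind => c.
  rewrite !mnmDE !mnm1E !eq_vyx !addn0 !eq_vx.
  by case: (eqVneq a c) => [<-|_]; [right; rewrite eq_sym na|left].
rewrite !mnmDE !mnm1E !eq_vxy !add0n !eq_vy.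
by case: (eqVneq b c) => [<-|_]; [right; rewrite eq_sym nb|left].
Qed.

Lemma cmonE a b : 'X_[cmon a b] = 'X_(vx a) * 'X_(vy b) :> {mpoly k[n * n + n * n]}.
Proof. exact: mpolyXD. Qed.

(** For i = j the summand h = i vanishes; it is dropped because its two equal monomials could not be
    ordered strictly. *)
Lemma CmxE i j : Cmx k n i j =
  \sum_(h | ~~ ((i == j) && (h == i)))
    ('X_(vx (i, h)) * 'X_(vy (h, j)) - 'X_(vy (i, h)) * 'X_(vx (h, j))).
Proof.
rewrite /Cmx !mxE -sumrB [RHS]big_mkcond /=; apply: eq_bigr => h _.
rewrite !mxE; case: ifP => // /negbFE/andP[/eqP<- /eqP->].
by rewrite mulrC subrr.
Qed.

Lemma CmxE_terms i j : Cmx k n i j =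
  \sum_(t | ~~ ((i == j) && (t.1 == i)))
    (-1) ^+ (~~ t.2) *: 'X_[cmon (xcell i j t) (ycell i j t)].
Proof.
rewrite CmxE (reindex (fun x : bool * 'I_n => (x.2, x.1))) /=; last first.
  by exists (fun t => (t.2, t.1)) => -[].
rewrite -(pair_big predT (fun h => ~~ ((i == j) && (h == i)))
  (fun (b : bool) h =>
     (-1) ^+ (~~ b) *: 'X_[cmon (xcell i j (h, b)) (ycell i j (h, b))])) /=.
rewrite big_bool /= -big_split; apply: eq_bigr => h _ /=.
by rewrite /xcell /ycell /= !cmonE scale1r expr1 scaleN1r ['X_(vy _) * _]mulrC.
Qed.

Variables wx wy : cell -> nat.
Local Notation w := (wt wx wy).

Lemma wt_gt0 v : (0 < w v)%N. Proof. by rewrite /wt addn1. Qed.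

Lemma wt_vx a : w (vx a) = (wx a + 1)%N.
Proof. by case: a => i j; rewrite /wt row_mxEl mxvecE mxE. Qed.

Lemma wt_vy a : w (vy a) = (wy a + 1)%N.
Proof. by case: a => i j; rewrite /wt row_mxEr mxvecE mxE. Qed.

Lemma wdeg_cmon a b : wdeg w (cmon a b) = (wx a + wy b + 2)%N.
Proof. by rewrite wdegD !wdegU wt_vx wt_vy addnACA. Qed.

Definition wterm i j t := (wx (xcell i j t) + wy (ycell i j t))%N.

Definition dominant i j t0 :=
  ~~ ((i == j) && (t0.1 == i)) /\
  forall t, ~~ ((i == j) && (t.1 == i)) -> t != t0 ->
    (wterm i j t < wterm i j t0)%N.

Lemma Cmx_lead i j t0 : dominant i j t0 ->
  Cmx k n i j != 0 /\ lm w (Cmx k n i j) = cmon (xcell i j t0) (ycell i j t0).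
Proof.
case=> h0 ht; rewrite CmxE_terms (bigD1 t0) //=; apply: lm_eq.
- exact: wt_gt0.
- by rewrite signr_eq0.
apply: wless_sum => t /andP[tP tt0]; apply: wlessZX.
by rewrite !wdeg_cmon ltn_add2r; apply: ht.
Qed.
End CommutatorLeads.
(** * Two monomial orders for n >= 3 *)

(* With n = m + 1, [mid] is the index r = (n - 1) / 2 and r' its mirror image; they
   coincide exactly when n is odd. The type of an index is r, r', 0, n - 1, or
   else [Lo] or [Hi] according to the side of r on which it lies. *)
Inductive itype := Mid | Mid' | First | Last | Lo | Hi.

Inductive irel := Same | Opp | Oth.

Definition itype_code c :=
  match c with Mid => 0 | Mid' => 1 | First => 2 | Last => 3 | Lo => 4 | Hi => 5 end%N.

Lemma itype_codeK :
  pcancel itype_code (fun c => nth None (map Some [:: Mid; Mid'; First; Last; Lo; Hi]) c).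
Proof. by case. Qed.

HB.instance Definition _ := Equality.copy itype (pcan_type itype_codeK).

Definition irel_code p := match p with Same => 0 | Opp => 1 | Oth => 2 end%N.

Lemma irel_codeK : pcancel irel_code (fun c => nth None (map Some [:: Same; Opp; Oth]) c).
Proof. by case. Qed.

HB.instance Definition _ := Equality.copy irel (pcan_type irel_codeK).

Definition mirror c :=
  match c with
  | Mid => Mid' | Mid' => Mid | First => Last | Last => First | Lo => Hi | Hi => Lo
  end.

Definition flip p := match p with Same => Opp | Opp => Same | Oth => Oth end.

Definition unique_type c := match c with Lo | Hi => false | _ => true end.

(** Necessary conditions on the types of two indices and their relation, with [ev] for n even. Over
    these finitely many combinations the weight inequalities can be checked by computation for all n
    at once. *)
Definition consistent ev ci ck p :=
  [&& ev || (ci != Mid') && (ck != Mid') &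
    match p with
    | Same => ck == ci
    | Opp => (ck == mirror ci) && (ev || (ci != Mid))
    | Oth => unique_type ci ==> (ck != ci) && (ck != mirror ci)
    end].

Section IndexTypes.
Variable m : nat.
Hypothesis m_gt1 : (1 < m)%N.
Implicit Types i j h : 'I_m.+1.

Definition mid : 'I_m.+1 := inord m./2.

Lemma val_mid : mid = m./2 :> nat.
Proof. by rewrite inordK //; lia. Qed.

Definition itype_of i :=
  if i == mid then Mid else if i == rev_ord mid then Mid'
  else if i == ord0 then First else if i == ord_max then Last
  else if (i < mid)%N then Lo else Hi.

(** [Same] takes precedence over [Opp], so the centre of an odd n is in relation [Same] to
    itself. *)
Definition irel_of i j := if i == j then Same else if j == rev_ord i then Opp else Oth.

(** The index of a type that occurs only once; for [Lo] and [Hi] the value [mid] is a dummy. *)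
Definition rep c :=
  match c with Mid' => rev_ord mid | First => ord0 | Last => ord_max | _ => mid end.

Variant itype_spec i : itype -> Type :=
  | IsMid of i = m./2 :> nat : itype_spec i Mid
  | IsMid' of odd m & i = (m - m./2)%N :> nat : itype_spec i Mid'
  | IsFirst of i = 0%N :> nat : itype_spec i First
  | IsLast of i = m :> nat : itype_spec i Last
  | IsLo of (0 < i < m./2)%N : itype_spec i Lo
  | IsHi of (m - m./2 < i < m)%N : itype_spec i Hi.

Lemma itypeP i : itype_spec i (itype_of i).
Proof.
have im := ltn_ord i; rewrite /itype_of -!val_eqE /= val_mid.
case: eqP => [|?]; first by constructor.
case: eqP => [|?]; first by constructor; lia.
case: eqP => [|?]; first by constructor.
case: eqP => [|?]; first by constructor.
have [?|?] := ltnP i m./2; constructor; lia.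
Qed.

Variant irel_spec i j : irel -> Type :=
  | IsSame of i = j & (i : nat) = j : irel_spec i j Same
  | IsOpp of (i : nat) <> j & j = rev_ord i & (i + j = m)%N : irel_spec i j Opp
  | IsOth of (i : nat) <> j & (i + j)%N <> m : irel_spec i j Oth.

Lemma irelP i j : irel_spec i j (irel_of i j).
Proof.
rewrite /irel_of; case: eqP => [|ne]; first by move=> ->; constructor.
have im := ltn_ord i; case: eqP => [E|nr]; constructor=> //.
- by move=> Ej; apply/ne/val_inj.
- by rewrite E /=; lia.
- by move=> E; apply/ne/val_inj.
- by move=> E; apply/nr/val_inj; rewrite /=; lia.
Qed.

Lemma itype_consistent i h : consistent (odd m) (itype_of i) (itype_of h) (irel_of i h).
Proof.
have := ltn_ord i; have := ltn_ord h; rewrite /consistent.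
case: (boolP (odd m)) => om; case: irelP => [-> _|ne _ E|ne E];
  case: (itypeP h) => *; try (by []); try (by exfalso; lia);
  case: (itypeP i) => *; first [by []|exfalso; lia].
Qed.

Lemma itype_rev i : odd m || (itype_of i != Mid) ->
  itype_of (rev_ord i) = mirror (itype_of i).
Proof.
have := ltn_ord i; case: (boolP (odd m)) => om;
  case: (itypeP i) => //= *; case: (itypeP (rev_ord i)) => //= *; lia.
Qed.

Lemma repK h : unique_type (itype_of h) -> rep (itype_of h) = h.
Proof. by case: itypeP => //= *; apply: val_inj; rewrite /= ?val_mid //; lia. Qed.

Lemma itype_rep c : unique_type c -> odd m || (c != Mid') -> itype_of (rep c) = c.
Proof.
by move=> uc hc; case: (itypeP (rep c)); case: c uc hc => //= _;
   rewrite ?val_mid /=; lia.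
Qed.

Lemma irel_ofC i j : irel_of i j = irel_of j i.
Proof.
have := ltn_ord i; have := ltn_ord j.
by case: (irelP i j) => *; case: (irelP j i) => // *; lia.
Qed.

Lemma irel_rev i h : odd m || (itype_of i != Mid) ->
  irel_of h (rev_ord i) = flip (irel_of i h).
Proof.
move=> hi; have := ltn_ord i; have := ltn_ord h.
case: (irelP i h) => *; case: (irelP h (rev_ord i)) => //= *; try lia.
all: by move: hi; case: (itypeP i) => //= *; lia.
Qed.

Definition typed T (f : itype -> itype -> irel -> T) (a : 'I_m.+1 * 'I_m.+1) :=
  f (itype_of a.1) (itype_of a.2) (irel_of a.1 a.2).

Definition entry (d : bool) i := if d then i else rev_ord i.

(** The centre of an odd n lies on both diagonals and counts as diagonal only. For n even the
    diagonal entry of type [Mid] is left out; the trace relation recovers it. *)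
Definition admissible ev (d : bool) ci :=
  (ev || (ci != Mid')) && (if d then ~~ ev || (ci != Mid) else ev || (ci != Mid)).

Lemma eq_entry d i : admissible (odd m) d (itype_of i) -> (i == entry d i) = d.
Proof.
case: d => /andP[_ h]; rewrite /= ?eqxx //; apply/negP => /eqP/(congr1 val) /=.
have := ltn_ord i; move: h; case: (boolP (odd m)) => om; case: itypeP => //= *; lia.
Qed.

(* The value of [typed f] at one of the two cells of the term ([ck], [p]) of the
   entry (i, i) if [d], (i, i') if not, when i has type [ci]. *)
Definition typed_term T (f : itype -> itype -> irel -> T) (d : bool) ci ck p (b : bool) :=
  if b then f ci ck p
  else f ck (if d then ci else mirror ci) (if d then p else flip p).

Lemma typed_xcell T (f : itype -> itype -> irel -> T) d i h b :
  admissible (odd m) d (itype_of i) ->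
  typed f (xcell i (entry d i) (h, b)) =
  typed_term f d (itype_of i) (itype_of h) (irel_of i h) b.
Proof.
rewrite /typed /typed_term /xcell; case: b => //; case: d => /andP[_ hi] /=.
  by rewrite (irel_ofC h i).
by rewrite irel_rev // itype_rev.
Qed.

Lemma typed_ycell T (f : itype -> itype -> irel -> T) d i h b :
  admissible (odd m) d (itype_of i) ->
  typed f (ycell i (entry d i) (h, b)) =
  typed_term f d (itype_of i) (itype_of h) (irel_of i h) (~~ b).
Proof. by move=> /(typed_xcell f h (~~ b)) <-; case: b. Qed.

Definition pick i (p : irel) c :=
  match p with Same => i | Opp => rev_ord i | Oth => rep c end.

(** No other index shares the type and relation of the picked one, so strict inequalities between
    types transfer to the individual terms of an entry. *)
Lemma pick_irel i p c : consistent (odd m) (itype_of i) c p ->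
  (p == Oth) ==> unique_type c ->
  [/\ itype_of (pick i p c) = c, irel_of i (pick i p c) = p &
    forall h, itype_of h = c -> irel_of i h = p -> h = pick i p c].
Proof.
case: p => /andP[ev hc] uc /=.
- rewrite (eqP hc); split=> // [|h _]; first by rewrite /irel_of eqxx.
  by case: irelP.
- have /andP[/eqP-> hi] := hc; split=> [||h _].
  + exact: itype_rev.
  + have ad : admissible (odd m) false (itype_of i).
      by rewrite /admissible hi; case: (odd m) ev => // /andP[->].
    by have /= := eq_entry ad; rewrite /irel_of => ->; rewrite eqxx.
  by case: irelP.
have {}ev : odd m || (c != Mid') by case/orP: ev => [->|/andP[_ ->]]; rewrite ?orbT.
have Ec := itype_rep uc ev; split=> // [|h hh _]; last by rewrite -hh repK // hh.
have := itype_consistent i (rep c); rewrite Ec /consistent.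
case/andP=> _; move: (irel_of _ _) hc uc => q.
by case: (itype_of i); case: (c); case: q.
Qed.

Variable W : itype -> itype -> irel -> nat * nat.
Variable ld : bool -> itype -> (irel * itype) * bool.

Definition wtyped d ci ck p b :=
  ((typed_term W d ci ck p b).1 + (typed_term W d ci ck p (~~ b)).2)%N.

(** [ld d ci] prescribes the leading term: the relation and type of the summation index h, and which
    of the two products with this h it is. *)
Definition leading ev :=
  forall d ci, admissible ev d ci ->
  let: ((p0, c0), b0) := ld d ci in
  [/\ consistent ev ci c0 p0, (p0 == Oth) ==> unique_type c0, ~~ (d && (p0 == Same))
    & forall ck p b, consistent ev ci ck p -> ~~ (d && (p == Same)) ->
        (p, ck, b) != (p0, c0, b0) ->
        (wtyped d ci ck p b < wtyped d ci c0 p0 b0)%N].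

Definition lterm d i :=
  let: ((p, c), b) := ld d (itype_of i) in (pick i p c, b).

Lemma leading_dominant d i : leading (odd m) -> admissible (odd m) d (itype_of i) ->
  dominant (fun a => (typed W a).1) (fun a => (typed W a).2) i (entry d i) (lterm d i).
Proof.
move=> hW ad; have := hW d _ ad; rewrite /lterm.
case: (ld d (itype_of i)) => [[p0 c0] b0] [hc hu hd hlt].
have [Ec Ep uniq_h] := pick_irel hc hu; split=> /=.
  rewrite eq_entry // negb_and; case: d {ad hW hlt} hd => //= hd.
  by apply: contraNneq hd => E; rewrite -Ep E /irel_of eqxx.
move=> [h b] /= hP ne; rewrite /wterm !typed_xcell // !typed_ycell // Ec Ep.
apply: hlt; first exact: itype_consistent.
  move: hP; rewrite eq_entry //; apply: contra => /andP[-> /=].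
  by case: irelP => // ->; rewrite eqxx.
apply: contraNneq ne => -[E1 E2 ->].
by rewrite (uniq_h h).
Qed.

End IndexTypes.

(* The weights of x_ij and y_ij, for two monomial orders. The first one makes the
   leading monomials of the entries coprime to those of the determinants
   x_ii' y_i'i - y_ii' x_i'i; for the second one they all involve an eliminated
   variable. The numbers solve the resulting linear inequalities. *)
Definition weight1 ci cj p :=
  match p, ci, cj with
  | Same, Mid, _ => (5, 0) | Same, (First | Lo), _ => (6, 0)
  | Opp, Mid, _ => (1, 0) | Opp, (First | Lo), _ => (2, 2)
  | Opp, (Last | Hi), _ => (0, 1)
  | Oth, First, Mid => (4, 4) | Oth, Mid, (First | Lo) => (3, 4)
  | Oth, Mid, (Last | Hi) => (0, 3) | Oth, (Last | Hi), Mid => (4, 6)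
  | Oth, Mid', First => (3, 0) | Oth, Last, Mid' => (0, 4)
  | _, _, _ => (0, 0)
  end%N.

Definition lead1 (d : bool) ci :=
  match d, ci with
  | true, Mid => ((Oth, First), false)
  | true, Mid' => ((Oth, Last), true)
  | true, _ => ((Oth, Mid), true)
  | false, (Mid | First | Lo) => ((Same, ci), true)
  | false, Mid' => ((Oth, First), true)
  | false, (Last | Hi) => ((Oth, Mid), false)
  end.

Definition weight2 (ev : bool) ci cj p :=
  match p, ci, cj with
  | Same, (Mid | First | Lo), _ => (20, 20)
  | Opp, (Mid | First | Lo), _ => (0, 1) | Opp, _, _ => (1, 0)
  | Oth, Mid, First => (if ev then 0 else 6, 0)
  | Oth, First, Mid => (0, if ev then 0 else 6)
  | Oth, Mid, (Lo | Last | Hi) => (5, 0) | Oth, (Lo | Last | Hi), Mid => (0, 5)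
  | Oth, First, Mid' => (3, 0) | Oth, Mid', First => (0, 3)
  | Oth, Last, Mid' => (4, 0) | Oth, Mid', Last => (0, 4)
  | _, _, _ => (0, 0)
  end%N.

Definition lead2 (ev d : bool) ci :=
  match d, ci with
  | true, Mid => ((Oth, First), true)
  | true, Mid' => ((Oth, Last), false)
  | true, First => if ev then ((Oth, Mid'), true) else ((Oth, Mid), false)
  | true, _ => ((Oth, Mid), false)
  | false, (Mid | First | Lo) => ((Same, ci), true)
  | false, (Mid' | Last | Hi) => ((Opp, mirror ci), true)
  end.

(** Exhaustive computation over types and relations; n enters only through its parity. *)
Lemma leading1 ev : leading weight1 lead1 ev.
Proof. by case: ev => -[] [] // _ /=; split=> // -[] [] []. Qed.

Lemma leading2 ev : leading (weight2 ev) (lead2 ev) ev.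
Proof. by case: ev => -[] [] // _ /=; split=> // -[] [] []. Qed.
(** * Primality for n >= 3 *)

Section LargeSize.
Variables (k : fieldType) (m : nat).
Hypothesis m_gt1 : (1 < m)%N.
(** Selects the ideal: the one with the diagonal entries if true, the anti-diagonal one if false. In
    the first case the middle diagonal entry is omitted and recovered from the trace; in the second
    the centre of an odd n is labelled as a diagonal entry. *)
Variable diag : bool.
Local Notation n := m.+1.
Local Notation ev := (odd m).
Local Notation R := {mpoly k[n * n + n * n]}.
Implicit Types i j h : 'I_n.

(* The label (true, i) stands for the entry (i, i), and (false, i) for (i, i'). *)
Definition label (e : bool * 'I_n) :=
  if e.1 then (if diag then e.2 != mid m else ~~ ev && (e.2 == mid m))
  else ev || (e.2 != mid m).

Definition labels := [seq e <- enum {: bool * 'I_n} | label e].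

Definition gen (e : bool * 'I_n) : R := Cmx k n e.2 (entry e.1 e.2).

Lemma labels_uniq : uniq labels.
Proof. by rewrite filter_uniq ?enum_uniq. Qed.

Lemma mem_labels e : (e \in labels) = label e.
Proof. by rewrite mem_filter mem_enum andbT. Qed.

Lemma itype_mid i : (itype_of i == Mid) = (i == mid m).
Proof. by rewrite /itype_of; case: (i == mid m) => //; do ![case: ifP => // _]. Qed.

Lemma label_admissible d i : label (d, i) -> admissible ev d (itype_of i).
Proof.
rewrite /label /admissible itype_mid /=.
have -> : ev || (itype_of i != Mid') by case: itypeP => //= *; rewrite ?orbT //; lia.
by case: d => //=; case: diag => [->|/andP[->]]; rewrite ?orbT.
Qed.

Lemma label_diag_type i : label (true, i) -> (itype_of i == Mid) = ~~ diag.
Proof. by rewrite /label itype_mid /=; case: diag => [/negbTE|/andP[]]. Qed.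

Definition xlead ld (e : bool * 'I_n) := xcell e.2 (entry e.1 e.2) (lterm ld e.1 e.2).
Definition ylead ld (e : bool * 'I_n) := ycell e.2 (entry e.1 e.2) (lterm ld e.1 e.2).

Definition nat_cell (a : 'I_n * 'I_n) := (a.1 : nat, a.2 : nat).

Lemma nat_cell_inj : injective nat_cell.
Proof. by move=> [? ?] [? ?] [/val_inj-> /val_inj->]. Qed.

(** The positions of the leading variables as explicit numbers, so that coincidences between them
    become linear arithmetic in m, r and the row. *)
Definition xlead1_nat (d : bool) c (x : nat) :=
  let r := m./2 in match d, c with
  | true, Mid => (0, r) | true, Mid' => (m - r, m) | true, _ => (x, r)
  | false, (Mid | First | Lo) => (x, x)
  | false, Mid' => (m - r, 0) | false, (Last | Hi) => (r, m - x)
  end%N.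

Definition ylead1_nat (d : bool) c (x : nat) :=
  let r := m./2 in match d, c with
  | true, Mid => (r, 0) | true, Mid' => (m, m - r) | true, _ => (r, x)
  | false, (Mid | First | Lo) => (x, m - x)
  | false, Mid' => (0, r) | false, (Last | Hi) => (x, r)
  end%N.

Definition xlead2_nat (d : bool) c (x : nat) :=
  let r := m./2 in match d, c with
  | true, Mid => (r, 0) | true, Mid' => (m, m - r)
  | true, First => if ev then (0, m - r) else (r, 0) | true, _ => (r, x)
  | false, (Mid | First | Lo) => (x, x)
  | false, (Mid' | Last | Hi) => (x, m - x)
  end%N.

Definition ylead2_nat (d : bool) c (x : nat) :=
  let r := m./2 in match d, c with
  | true, Mid => (0, r) | true, Mid' => (m - r, m)
  | true, First => if ev then (m - r, 0) else (0, r) | true, _ => (x, r)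
  | false, (Mid | First | Lo) => (x, m - x)
  | false, (Mid' | Last | Hi) => (m - x, m - x)
  end%N.

Lemma xlead1E d i : nat_cell (xlead lead1 (d, i)) = xlead1_nat d (itype_of i) i.
Proof.
rewrite /xlead /xcell /lterm /nat_cell /entry.
by case: d; case: itypeP => /= *; rewrite ?val_mid //=; congr (_, _); lia.
Qed.

Lemma ylead1E d i : nat_cell (ylead lead1 (d, i)) = ylead1_nat d (itype_of i) i.
Proof.
rewrite /ylead /ycell /lterm /nat_cell /entry.
by case: d; case: itypeP => /= *; rewrite ?val_mid //=; congr (_, _); lia.
Qed.

Lemma xlead2E d i : nat_cell (xlead (lead2 ev) (d, i)) = xlead2_nat d (itype_of i) i.
Proof.
rewrite /xlead /xcell /lterm /nat_cell /entry /lead2 /xlead2_nat.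
by case: d; case: itypeP => /= *; case: (odd m);
  rewrite /= ?val_mid //=; congr (_, _); lia.
Qed.

Lemma ylead2E d i : nat_cell (ylead (lead2 ev) (d, i)) = ylead2_nat d (itype_of i) i.
Proof.
rewrite /ylead /ycell /lterm /nat_cell /entry /lead2 /ylead2_nat.
by case: d; case: itypeP => /= *; case: (odd m);
  rewrite /= ?val_mid //=; congr (_, _); lia.
Qed.

Lemma label_nat d i : label (d, i) ->
  if d then (if diag then (i != m./2 :> nat) else ~~ ev && (i == m./2 :> nat))
  else ev || (i != m./2 :> nat).
Proof. by rewrite /label -!val_eqE /= val_mid. Qed.

Lemma xlead1_inj : {in label &, injective (xlead lead1)}.
Proof.
move=> [d i] [d' i'] /label_nat hl /label_nat hl' /(congr1 nat_cell).
rewrite !xlead1E => E; suff [-> /val_inj->] : d = d' /\ i = i' :> nat by [].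
move: hl hl' (congr1 fst E) (congr1 snd E) => {E}.
case: d; case: d'; case: diag; case: (boolP ev) => om;
  case: itypeP => //=; case: itypeP => //= *; lia.
Qed.

Lemma ylead1_inj : {in label &, injective (ylead lead1)}.
Proof.
move=> [d i] [d' i'] /label_nat hl /label_nat hl' /(congr1 nat_cell).
rewrite !ylead1E => E; suff [-> /val_inj->] : d = d' /\ i = i' :> nat by [].
move: hl hl' (congr1 fst E) (congr1 snd E) => {E}.
case: d; case: d'; case: diag; case: (boolP ev) => om;
  case: itypeP => //=; case: itypeP => //= *; lia.
Qed.

Lemma xlead2_inj : {in label &, injective (xlead (lead2 ev))}.
Proof.
move=> [d i] [d' i'] /label_nat hl /label_nat hl' /(congr1 nat_cell).
rewrite !xlead2E /xlead2_nat => E; suff [-> /val_inj->] : d = d' /\ i = i' :> nat by [].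
move: hl hl' (congr1 fst E) (congr1 snd E) => {E}.
case: d; case: d'; case: diag; case: (boolP ev) => om;
  case: itypeP => //=; case: itypeP => //= *; lia.
Qed.

Lemma ylead2_inj : {in label &, injective (ylead (lead2 ev))}.
Proof.
move=> [d i] [d' i'] /label_nat hl /label_nat hl' /(congr1 nat_cell).
rewrite !ylead2E /ylead2_nat => E; suff [-> /val_inj->] : d = d' /\ i = i' :> nat by [].
move: hl hl' (congr1 fst E) (congr1 snd E) => {E}.
case: d; case: d'; case: diag; case: (boolP ev) => om;
  case: itypeP => //=; case: itypeP => //= *; lia.
Qed.

Definition mu ld e := cmon (xlead ld e) (ylead ld e).

Definition typed_wt (W : itype -> itype -> irel -> nat * nat) :=
  wt (fun a : 'I_n * 'I_n => (typed W a).1) (fun a => (typed W a).2).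

Local Notation w1 := (typed_wt weight1).

(** Each lead is one x-variable times one y-variable, and distinct generators differ in both. *)
Lemma coprime_gen W ld : leading W ld ev ->
  {in label &, injective (xlead ld)} -> {in label &, injective (ylead ld)} ->
  coprime_leads (typed_wt W) gen (mu ld) labels.
Proof.
move=> hW xi yi; split; first exact: labels_uniq.
  move=> [d i]; rewrite mem_labels => /label_admissible ad.
  exact/Cmx_lead/leading_dominant.
move=> e e'; rewrite !mem_labels => he he' ne.
by apply: cmon_disjoint; apply: contra ne => /eqP; [move/xi|move/yi] => ->.
Qed.

Lemma coprime_gen1 : coprime_leads w1 gen (mu lead1) labels.
Proof. apply: coprime_gen; [exact: leading1|exact: xlead1_inj|exact: ylead1_inj]. Qed.

Lemma coprime_gen2 : coprime_leads (typed_wt (weight2 ev)) gen (mu (lead2 ev)) labels.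
Proof. apply: coprime_gen; [exact: leading2|exact: xlead2_inj|exact: ylead2_inj]. Qed.

(** * Non-zero-divisors obtained from the first order *)

Local Notation nzd1 := (nzd labels gen).
Local Notation x a := ('X_(vx a) : R).
Local Notation y a := ('X_(vy a) : R).

Lemma nzd_x a : {in label, forall e, xlead lead1 e != a} -> nzd1 (x a).
Proof.
move=> ha; apply: (nzd_coprime_lead _ coprime_gen1) => [v||e]; first exact: wt_gt0.
  exact: mpolyX_neq0.
rewrite mem_labels => /ha ne; rewrite lmX; last exact: wt_gt0.
apply: var_ind => c.
  rewrite mnmDE !mnm1E eq_vyx addn0 !eq_vx.
  by case: (eqVneq a c) => [<-|_]; [left; rewrite (negbTE ne)|right].
by right; rewrite mnm1E eq_vxy.
Qed.

Lemma nzd_y a : {in label, forall e, ylead lead1 e != a} -> nzd1 (y a).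
Proof.
move=> ha; apply: (nzd_coprime_lead _ coprime_gen1) => [v||e]; first exact: wt_gt0.
  exact: mpolyX_neq0.
rewrite mem_labels => /ha ne; rewrite lmX; last exact: wt_gt0.
apply: var_ind => c.
  by right; rewrite mnm1E eq_vyx.
rewrite mnmDE !mnm1E eq_vxy add0n !eq_vy.
by case: (eqVneq a c) => [<-|_]; [left; rewrite (negbTE ne)|right].
Qed.

Definition det_opp i : R :=
  x (i, rev_ord i) * y (rev_ord i, i) - y (i, rev_ord i) * x (rev_ord i, i).

(** For the first order x_ii' y_i'i leads when i < i', and neither of its factors occurs in the lead
    of a generator. *)
Lemma nzd_det i : (i < rev_ord i)%N -> nzd1 (det_opp i).
Proof.
move=> lti; pose a := (i, rev_ord i); pose b := (rev_ord i, i).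
have E : det_opp i = 1 *: 'X_[cmon a b] + (-1) *: 'X_[cmon b a].
  by rewrite !cmonE scale1r scaleN1r /det_opp [y _ * _]mulrC.
have hO : irel_of i (rev_ord i) = Opp.
  by case: irelP => //= *; exfalso; move: lti => /=; lia.
have hi : ev || (itype_of i != Mid).
  by case: (boolP ev) => //= om; case: itypeP => // *; move: lti => /=; lia.
have [|||nz lmE] := @lm_eq k _ w1 _ 1 (cmon a b) ((-1) *: 'X_[cmon b a]).
- by move=> v; apply: wt_gt0.
- exact: oner_neq0.
- apply: wlessZX; rewrite !wdeg_cmon ltn_add2r /typed /=.
  rewrite (irel_ofC m_gt1 (rev_ord i)) hO itype_rev //.
  by move: hi lti; case: itypeP => //= *; lia.
rewrite E; apply: (nzd_coprime_lead _ coprime_gen1) => // [v|[d j]].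
  exact: wt_gt0.
rewrite mem_labels lmE => hl; apply: cmon_disjoint; apply/eqP.
  move/(congr1 nat_cell); rewrite xlead1E => E1.
  move: (label_nat hl) (congr1 fst E1) (congr1 snd E1) lti => {E1}.
  by case: d {hl}; case: diag; case: (boolP ev) => om; case: itypeP => //= *; lia.
move/(congr1 nat_cell); rewrite ylead1E => E1.
move: (label_nat hl) (congr1 fst E1) (congr1 snd E1) lti => {E1}.
by case: d {hl}; case: diag; case: (boolP ev) => om; case: itypeP => //= *; lia.
Qed.

(* The order in which the eliminated variables are solved for; level 0 stands for
   the variables which are kept. *)
Definition xlevel ci cj p :=
  match p, ci, cj with
  | Same, Mid, _ => if ev then 4 else 0
  | Same, (First | Lo), _ => 4
  | Oth, Mid, First => if ev then 0 else 1
  | Oth, Mid, Lo => if diag then 1 else 0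
  | Oth, Last, Mid' => if diag then 2 else 0
  | _, _, _ => 0
  end%N.

Definition ylevel ci cj p :=
  match p, ci, cj with
  | Same, Mid, _ => if ev then 4 else 0
  | Same, (First | Lo), _ => 4
  | Oth, Mid', First => if diag then 1 else 0
  | Oth, (Last | Hi), Mid => if diag then 3 else 0
  | _, _, _ => 0
  end%N.

Definition elim v := [exists a : 'I_n * 'I_n,
  (v == vx a) && (0 < typed xlevel a)%N || (v == vy a) && (0 < typed ylevel a)%N].

Lemma elim_vx a : elim (vx a) = (0 < typed xlevel a)%N.
Proof.
apply/existsP/idP => [[b]|h]; last by exists a; rewrite eqxx h.
by rewrite eq_vx eq_vxy orbF => /andP[/eqP->].
Qed.

Lemma elim_vy a : elim (vy a) = (0 < typed ylevel a)%N.
Proof.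
apply/existsP/idP => [[b]|h]; last by exists a; rewrite eqxx h orbT.
by rewrite eq_vy eq_vyx => /andP[/eqP->].
Qed.

Lemma lead2_elim e : label e ->
  (0 < typed xlevel (xlead (lead2 ev) e))%N || (0 < typed ylevel (ylead (lead2 ev) e))%N.
Proof.
case: e => d i hl; have ad := label_admissible hl.
rewrite /xlead /ylead /lterm /=.
have := leading2 ad; case E : (lead2 ev d (itype_of i)) => [[p c] b].
case=> hc hu _ _; have [Ec Ep _] := pick_irel m_gt1 hc hu.
rewrite typed_xcell // typed_ycell // Ec Ep.
move: E ad hc; rewrite /typed_term /xlevel /ylevel; case: d hl => hl.
  move: (label_diag_type hl); move: (itype_of i) => ci.
  by case: diag; case: (odd m); case: ci => //= _ [<- <- <-].
by case: (odd m); case: (itype_of i) => //= -[<- <- <-].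
Qed.

(** By the second order, the lead of a nonzero [p] in the ideal would be divisible by that of a
    generator, hence by an eliminated variable. *)
Lemma span_avoids_gen p : avoids elim p -> span labels gen p -> p = 0.
Proof.
move=> ap sp; apply/eqP/negPn/negP => p0.
have w_gt0 v : (0 < typed_wt (weight2 ev) v)%N by apply: wt_gt0.
have [e] := lm_span w_gt0 coprime_gen2 sp p0.
rewrite mem_labels => /lead2_elim he /mnm_lepP le.
have ae := ap _ (lm_supp w_gt0 p0).
case/orP: he => h.
  have := le (vx (xlead (lead2 ev) e)); rewrite ae ?elim_vx //.
  by rewrite mnmDE !mnm1E eqxx.
have := le (vy (ylead (lead2 ev) e)); rewrite ae ?elim_vy //.
by rewrite mnmDE !mnm1E eqxx addn1.
Qed.

(** * Elimination of the variables, level by level *)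

Local Notation tame := (tame labels gen elim).

(** The entry is solved for one factor of its term [t0], all other terms being tame; the other
    factor serves as the pivot. *)
Lemma tame_term d i t0 : label (d, i) ->
  let xt t := xcell i (entry d i) t in let yt t := ycell i (entry d i) t in
  ~~ ((i == entry d i) && (t0.1 == i)) ->
  (forall t, ~~ ((i == entry d i) && (t.1 == i)) -> t != t0 ->
     tame (x (xt t)) /\ tame (y (yt t))) ->
  (nzd1 (y (yt t0)) -> tame (y (yt t0)) -> tame (x (xt t0))) /\
  (nzd1 (x (xt t0)) -> tame (x (xt t0)) -> tame (y (yt t0))).
Proof.
move=> hl xt yt h0 ht.
pose s : R := ((-1) ^+ (~~ t0.2))%:MP.
have ts : tame s by apply/tame_avoids/avoidsC.
pose E := - s * \sum_(t | ~~ ((i == entry d i) && (t.1 == i)) && (t != t0))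
    (-1) ^+ (~~ t.2) *: 'X_[cmon (xt t) (yt t)].
have tE : tame E.
  apply: tameM; first exact: tameN.
  apply: tame_sum => t /andP[tP tt0]; have [tx ty] := ht t tP tt0.
  rewrite -mul_mpolyC cmonE; apply: tameM; first exact/tame_avoids/avoidsC.
  exact: tameM.
have sE : span labels gen (x (xt t0) * y (yt t0) - E).
  have -> : x (xt t0) * y (yt t0) - E = s * gen (d, i).
    rewrite /gen /= CmxE_terms (bigD1 t0) //= mulrDr /E mulNr opprK.
    rewrite -mul_mpolyC mulrA -/s -rmorphM /= -expr2 sqrr_sign mul1r.
    by rewrite cmonE.
  by apply/spanM/span_gen; rewrite ?mem_labels ?labels_uniq.
by split=> nz tm; apply: (tame_div nz tm tE); rewrite // mulrC.
Qed.

Definition tame_below s := forall a,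
  ((typed xlevel a < s)%N -> tame (x a)) /\ ((typed ylevel a < s)%N -> tame (y a)).

(** The level of the variable for which the diagonal entry of a row of this type is solved. *)
Definition stage ci :=
  match ci with Mid | First | Lo => 1 | Mid' => 2 | Last | Hi => 3 end%N.

(** Triangularity of the elimination: apart from the leading term, the entry involves only variables
    of lower level. *)
Lemma stageP ci p0 c0 b0 : lead2 ev true ci = (p0, c0, b0) ->
    admissible ev true ci -> (ci == Mid) = ~~ diag ->
  (forall ck p b, consistent ev ci ck p -> p != Same -> (p, ck, b) != (p0, c0, b0) ->
     (typed_term xlevel true ci ck p b < stage ci)%N /\
     (typed_term ylevel true ci ck p (~~ b) < stage ci)%N).
Proof.
rewrite /typed_term /xlevel /ylevel; case: ci; case: diag; case: (odd m) => //=;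
  by case=> <- <- <- _ _ [] [] [].
Qed.

(** Selects the pivot in the leading term for the second order: if true, the x-factor is inverted
    and the y-factor solved for; otherwise the reverse. *)
Definition x_factor ci :=
  match ci with Last | Hi => true | First => ev | _ => false end.

(** The pivot comes from a lead for the second order, but it is a non-zero-divisor because it occurs
    in no lead for the first. *)
Lemma nzd_x_factor i : label (true, i) -> x_factor (itype_of i) ->
  nzd1 (x (xlead (lead2 ev) (true, i))).
Proof.
move=> hi hf; apply: nzd_x => -[d j] hj; apply/eqP => /(congr1 nat_cell).
rewrite xlead1E xlead2E /xlead2_nat => E.
move: (label_nat hi) (label_nat hj) (congr1 fst E) (congr1 snd E) hf => {E}.
rewrite /x_factor; case: d {hj}; case: diag; case: (boolP ev) => om;
  case: (itypeP m_gt1 j) => //=; case: (itypeP m_gt1 i) => //= *; lia.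
Qed.

Lemma nzd_y_factor i : label (true, i) -> ~~ x_factor (itype_of i) ->
  nzd1 (y (ylead (lead2 ev) (true, i))).
Proof.
move=> hi hf; apply: nzd_y => -[d j] hj; apply/eqP => /(congr1 nat_cell).
rewrite ylead1E ylead2E /ylead2_nat => E.
move: (label_nat hi) (label_nat hj) (congr1 fst E) (congr1 snd E) hf => {E}.
rewrite /x_factor; case: d {hj}; case: diag; case: (boolP ev) => om;
  case: (itypeP m_gt1 j) => //=; case: (itypeP m_gt1 i) => //= *; lia.
Qed.

Lemma factor_level i : label (true, i) ->
  if x_factor (itype_of i) then typed xlevel (xlead (lead2 ev) (true, i)) = 0%N
  else typed ylevel (ylead (lead2 ev) (true, i)) = 0%N.
Proof.
move=> hl; have ad := label_admissible hl; rewrite /xlead /ylead /lterm.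
have := leading2 ad; case E : (lead2 ev true (itype_of i)) => [[p c] b].
case=> hc hu _ _; have [Ec Ep _] := pick_irel m_gt1 hc hu.
rewrite (typed_xcell m_gt1 xlevel _ _ ad) (typed_ycell m_gt1 ylevel _ _ ad) Ec Ep.
move: E ad; rewrite /typed_term /xlevel /ylevel /x_factor.
move: (label_diag_type hl); move: (itype_of i) => ci.
by case: diag; case: (odd m); case: ci => //= _ [<- <- <-].
Qed.

Lemma tame_stage i : label (true, i) -> tame_below (stage (itype_of i)) ->
  tame (x (xlead (lead2 ev) (true, i))) /\ tame (y (ylead (lead2 ev) (true, i))).
Proof.
move=> hl ht; have ad := label_admissible hl.
have [h0 _] := leading_dominant m_gt1 (@leading2 _) ad.
have s_gt0 : (0 < stage (itype_of i))%N by case: (itype_of i).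
have [|nx ny] := tame_term hl h0.
  move=> [h b] hP ne; have [h1 h2] : 
    (typed xlevel (xcell i i (h, b)) < stage (itype_of i))%N /\
    (typed ylevel (ycell i i (h, b)) < stage (itype_of i))%N.
    rewrite (typed_xcell m_gt1 xlevel _ _ ad) (typed_ycell m_gt1 ylevel _ _ ad).
    case E : (lead2 ev true (itype_of i)) => [[p0 c0] b0].
    apply: (stageP E ad (label_diag_type hl)).
    - exact: itype_consistent.
    - by move: hP; rewrite eqxx /=; case: irelP => // ->; rewrite eqxx.
    apply: contraNneq ne => -[E1 E2 E3]; rewrite /lterm E.
    have := leading2 ad; rewrite E => -[hc hu _ _].
    by have [_ _ uh] := pick_irel m_gt1 hc hu; rewrite (uh h E2 E1) E3.
  by split; [apply: (ht _).1|apply: (ht _).2].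
have := factor_level hl; case: ifP => hf E.
  have tx : tame (x (xlead (lead2 ev) (true, i))) by apply: (ht _).1; rewrite E.
  by split=> //; apply: ny => //; apply: nzd_x_factor.
have ty : tame (y (ylead (lead2 ev) (true, i))) by apply: (ht _).2; rewrite E.
by split=> //; apply: nx => //; apply: nzd_y_factor; rewrite ?hf.
Qed.

Lemma target_x a : (0 < typed xlevel a < 4)%N -> exists i,
  [/\ label (true, i), stage (itype_of i) = typed xlevel a &
      xlead (lead2 ev) (true, i) = a].
Proof.
(* With the diagonal entries among the generators, x_ij is solved from the entry (j, j); otherwise
   only the centre of an odd n is available. *)
case: a => i j H; pose h := if diag then j else mid m; exists h.
suff [h1 h2 h3] : [/\ label (true, h), stage (itype_of h) = typed xlevel (i, j) &
    xlead2_nat true (itype_of h) h = nat_cell (i, j)].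
  by split=> //; apply: nat_cell_inj; rewrite xlead2E.
have Em : itype_of (mid m) = Mid by apply/eqP; rewrite itype_mid.
move: H; rewrite /h /label /typed /xlevel /xlead2_nat /nat_cell /= -!itype_mid.
case: diag; rewrite ?Em.
  by case: (boolP ev) => om; case: (itypeP m_gt1 i) => hi; case: (itypeP m_gt1 j) => hj;
    case: irelP => //= *; split=> //; congr (_, _); lia.
by case: (boolP ev) => om; case: (itypeP m_gt1 i) => hi; case: (itypeP m_gt1 j) => hj;
  case: irelP => //= *; split=> //; congr (_, _); lia.
Qed.

Lemma target_y a : (0 < typed ylevel a < 4)%N -> exists i,
  [/\ label (true, i), stage (itype_of i) = typed ylevel a &
      ylead (lead2 ev) (true, i) = a].
Proof.
case: a => i j H.
suff [h [h1 h2 h3]] : exists h,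
    [/\ label (true, h), stage (itype_of h) = typed ylevel (i, j) &
      ylead2_nat true (itype_of h) h = nat_cell (i, j)].
  by exists h; split=> //; apply: nat_cell_inj; rewrite ylead2E.
move: H; rewrite /label /typed /ylevel /ylead2_nat /nat_cell /= => H.
(* In the column of [mid] the variable y_ij is solved from the entry (i, i), elsewhere from (j,
   j). *)
have [/eqP jm|jm] := boolP (itype_of j == Mid); [exists i|exists j]; move: jm H;
  rewrite -!itype_mid; case: diag; case: (boolP ev) => om;
    case: (itypeP m_gt1 j) => hj //=; case: (itypeP m_gt1 i) => hi;
    case: irelP => //= *; split=> //; congr (_, _); lia.
Qed.

Lemma tame_below_step s : (s < 4)%N -> tame_below s -> tame_below s.+1.
Proof.
move=> s4 hs a; split; rewrite ltnS leq_eqVlt => /orP[/eqP E|lt].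
- case: (posnP s) => [s0|s_gt0]; first by apply: tameX; rewrite elim_vx E s0.
  have [|i [hl Ei <-]] := @target_x a; first by rewrite E s_gt0.
  by apply: (tame_stage hl _).1; rewrite Ei E.
- exact: (hs a).1.
- case: (posnP s) => [s0|s_gt0]; first by apply: tameX; rewrite elim_vy E s0.
  have [|i [hl Ei <-]] := @target_y a; first by rewrite E s_gt0.
  by apply: (tame_stage hl _).2; rewrite Ei E.
exact: (hs a).2.
Qed.

Lemma tame_below4 : tame_below 4.
Proof. by do 4!apply: tame_below_step => //; move=> a. Qed.

(** Level 4 is reserved for diagonal variables. *)
Lemma tame_offdiag i j : i != j -> tame (x (i, j)) /\ tame (y (i, j)).
Proof.
move=> ne; have [hx hy] := tame_below4 (i, j).
by split; [apply: hx|apply: hy]; rewrite /typed /= /irel_of (negbTE ne);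
  case: ifP => _; rewrite /xlevel /ylevel; case: (itype_of i);
  case: (itype_of j); case: diag; case: (odd m).
Qed.

(* Cramer's rule for the entries (i, i') and (i', i), seen as two linear equations
   in x_ii - x_i'i' and y_ii - y_i'i'. *)
Lemma tame_cramer i : (i < rev_ord i)%N ->
  tame (x (rev_ord i, rev_ord i)) -> tame (y (rev_ord i, rev_ord i)) ->
  tame (x (i, i)) /\ tame (y (i, i)).
Proof.
move=> lti txj tyj; set j := rev_ord i in lti txj tyj *.
have ne : i != j by rewrite neq_ltn lti.
have ne' : j != i by rewrite eq_sym.
have rj : rev_ord j = i by rewrite rev_ordK.
pose rest a b : R := \sum_(h | (h != a) && (h != b))
  (x (a, h) * y (h, b) - y (a, h) * x (h, b)).
have Crest a b : a != b -> Cmx k n a b =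
    (x (a, a) - x (b, b)) * y (a, b) - (y (a, a) - y (b, b)) * x (a, b) + rest a b.
  move=> nab; rewrite CmxE (bigD1 a) ?(negbTE nab) //=.
  rewrite (bigD1 b) ?(negbTE nab) 1?eq_sym //= /rest.
  under eq_bigl do rewrite ?(negbTE nab) /=.
  ring.
have trest a b : tame (rest a b).
  apply: tame_sum => h /andP[ha hb].
  have ha' : a != h by rewrite eq_sym.
  have [t1 t2] := tame_offdiag ha'; have [t3 t4] := tame_offdiag hb.
  by apply: tameB; apply: tameM.
have [tF1 tF2] := tame_offdiag ne.
have [tG1 tG2] := tame_offdiag ne'.
have nd := nzd_det lti; rewrite /det_opp -/j in nd.
have td : tame (x (i, j) * y (j, i) - y (i, j) * x (j, i)).
  by apply: tameB; apply: tameM.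
have hl : label (false, i).
  rewrite /label /=; case: (boolP ev) => //= om; apply/eqP => E.
  by move: lti; rewrite /j E /= val_mid //; lia.
have hl' : label (false, j).
  rewrite /label /=; case: (boolP ev) => //= om; apply/eqP => E.
  by move: lti; rewrite -rj E /= val_mid //; lia.
have sij : span labels gen (Cmx k n i j).
  by apply: (span_gen _ labels_uniq (e := (false, i))); rewrite mem_labels.
have sji : span labels gen (Cmx k n j i).
  have := span_gen gen labels_uniq (e := (false, j)).
  by rewrite mem_labels /gen /= rj; apply.
split.
  (* The combination x_ji c_ij + x_ij c_ji eliminates y_ii - y_jj, and [e] collects what remains;
     the second half uses y_ji c_ij + y_ij c_ji in the same way. *)
  apply: (tame_div nd td (e := (x (i, j) * y (j, i) - y (i, j) * x (j, i)) * x (j, j)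
     + x (j, i) * rest i j + x (i, j) * rest j i)).
    by apply: tameD; [apply: tameD|]; apply: tameM.
  set u := (X in span _ _ X).
  have -> : u = - (x (j, i) * Cmx k n i j + x (i, j) * Cmx k n j i).
    by rewrite /u !Crest //; ring.
  by apply/spanN/spanD; apply: spanM.
apply: (tame_div nd td (e := (x (i, j) * y (j, i) - y (i, j) * x (j, i)) * y (j, j)
   + y (j, i) * rest i j + y (i, j) * rest j i)).
  by apply: tameD; [apply: tameD|]; apply: tameM.
set u := (X in span _ _ X).
have -> : u = - (y (j, i) * Cmx k n i j + y (i, j) * Cmx k n j i).
  by rewrite /u !Crest //; ring.
by apply/spanN/spanD; apply: spanM.
Qed.

Lemma tame_vars v : tame 'X_v.
Proof.
suff h a : tame (x a) /\ tame (y a) by elim/var_ind: v => a; case: (h a).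
case: a => i j; have [<-{j}|] := eqVneq i j; last exact: tame_offdiag.
(* Diagonal variables with h' <= h have level 0; the other half follows by Cramer's rule. *)
have up h : (rev_ord h <= h)%N -> tame (x (h, h)) /\ tame (y (h, h)).
  move=> le; have [hx hy] := tame_below4 (h, h).
  split; [apply: hx|apply: hy]; rewrite /typed /= /irel_of eqxx;
    rewrite /xlevel /ylevel; move: le; have := ltn_ord h;
    by case: (boolP ev) => om; case: (itypeP m_gt1 h) => //= *; lia.
have [le|lt] := leqP (rev_ord i) i; first exact: up.
by have [|tx ty] := up (rev_ord i); [rewrite rev_ordK ltnW|apply: tame_cramer].
Qed.

Lemma prime_ideal_gen (I : {pred R}) :
  (forall p, p \in I <-> span labels gen p) -> prime_ideal I.
Proof. by apply: prime_ideal_span; [exact: tame_vars|exact: span_avoids_gen]. Qed.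

End LargeSize.

(** * Generated ideals as spans of labelled families *)

Section IdealGen.
Variable R : comNzRingType.
Implicit Type s : seq R.

Lemma ideal_genP s p :
  reflect (exists a : 'I_(size s) -> R, p = \sum_i a i * s`_i) (p \in ideal_gen s).
Proof. exact: asboolP. Qed.

Lemma ideal_gen_mem s q : q \in s -> q \in ideal_gen s.
Proof.
move=> qs; have lt : (index q s < size s)%N by rewrite index_mem.
apply/ideal_genP; exists (fun i => (i == Ordinal lt)%:R).
rewrite (bigD1 (Ordinal lt)) //= eqxx mul1r nth_index // big1 ?addr0 //.
by move=> i /negbTE->; rewrite mul0r.
Qed.

Lemma ideal_genD s p q :
  p \in ideal_gen s -> q \in ideal_gen s -> p + q \in ideal_gen s.
Proof.
move=> /ideal_genP[a ->] /ideal_genP[b ->]; apply/ideal_genP.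
exists (fun i => a i + b i); rewrite -big_split; apply: eq_bigr => i _ /=.
by rewrite mulrDl.
Qed.

Lemma ideal_genM s p q : q \in ideal_gen s -> p * q \in ideal_gen s.
Proof.
move=> /ideal_genP[a ->]; apply/ideal_genP; exists (fun i => p * a i).
by rewrite mulr_sumr; apply: eq_bigr => i _; rewrite mulrA.
Qed.

Lemma ideal_gen0 s : 0 \in ideal_gen s.
Proof. by apply/ideal_genP; exists (fun=> 0); rewrite big1 // => i _; rewrite mul0r. Qed.

Lemma ideal_gen_span (L : eqType) (l : seq L) (g : L -> R) s :
  {in s, forall q, span l g q} -> {in l, forall e, g e \in s} ->
  forall p, p \in ideal_gen s <-> span l g p.
Proof.
move=> hs hl p; split=> [/ideal_genP[a ->]|[a ->]].
  by apply: span_sum => i _; apply/spanM/hs/mem_nth.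
rewrite big_seq; elim/big_rec: _ => [|e q el hq]; first exact: ideal_gen0.
by apply: ideal_genD hq; apply/ideal_genM/ideal_gen_mem/hl.
Qed.
End IdealGen.

(** * The cases n >= 3 and n = 1 *)

Section Cases.
Variable k : fieldType.

Lemma mem_diag n i : Cmx k n i i \in diag_entries (Cmx k n).
Proof. by apply: map_f; rewrite mem_enum. Qed.

Lemma mem_antidiag n i : Cmx k n i (rev_ord i) \in antidiag_entries (Cmx k n).
Proof. by apply: (map_f (fun i => Cmx k n i (rev_ord i))); rewrite mem_enum. Qed.

Lemma Cmx_trace n : \sum_i Cmx k n i i = 0.
Proof.
rewrite -[LHS]/(\tr (Cmx k n)) /Cmx raddfB /=.
by rewrite mxtrace_mulC subrr.
Qed.

Lemma mid_rev m (i : 'I_m.+1) : (1 < m)%N -> ~~ odd m -> i = mid m -> rev_ord i = i.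
Proof. by move=> m_gt1 om ->; apply: val_inj; rewrite /= val_mid //; lia. Qed.

Lemma antidiag_span m dg i : (1 < m)%N -> 
  span (labels m dg) (@gen k m) (Cmx k m.+1 i (rev_ord i)) \/ (~~ odd m /\ i = mid m).
Proof.
move=> m_gt1; case hl : (label dg (false, i)); [left|right].
  apply: (span_gen (@gen k m) (labels_uniq m dg) (e := (false, i))).
  by rewrite mem_labels.
by move/norP: (negbT hl) => [? /negbNE/eqP].
Qed.

Lemma prime_c m : (1 < m)%N -> prime_ideal (ideal_c k m.+1).
Proof.
move=> m_gt1; apply: (prime_ideal_gen m_gt1 (diag := true)).
have hd i : i != mid m -> span (labels m true) (@gen k m) (Cmx k m.+1 i i).
  move=> hi; apply: (span_gen (@gen k m) (labels_uniq m true) (e := (true, i))).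
  by rewrite mem_labels.
have hd' i : span (labels m true) (@gen k m) (Cmx k m.+1 i i).
  have [->|] := eqVneq i (mid m); last exact: hd.
  (* The trace of a commutator vanishes, so the omitted diagonal entry is minus the sum of the
     others. *)
  have := Cmx_trace m.+1; rewrite (bigD1 (mid m)) //= => /eqP.
  by rewrite addr_eq0 => /eqP->; apply/spanN/span_sum => j /hd.
apply: ideal_gen_span => [q|[d i] _].
  rewrite mem_cat => /orP[] /mapP[i _ ->]; first exact: hd'.
  have [//|[om E]] := antidiag_span true i m_gt1.
  by rewrite (mid_rev m_gt1 om E); apply: hd'.
by case: d; rewrite mem_cat ?mem_diag //= mem_antidiag orbT.
Qed.

Lemma prime_a m : (1 < m)%N -> prime_ideal (ideal_a k m.+1).
Proof.
move=> m_gt1; apply: (prime_ideal_gen m_gt1 (diag := false)).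
apply: ideal_gen_span => [q|[d i]].
  move=> /mapP[i _ ->]; have [//|[om E]] := antidiag_span false i m_gt1.
  rewrite (mid_rev m_gt1 om E).
  apply: (span_gen (@gen k m) (labels_uniq m false) (e := (true, i))).
  by rewrite mem_labels /label /= om E eqxx.
rewrite mem_labels; case: d => [/andP[om /eqP /= E]|_]; last exact: mem_antidiag.
by rewrite /gen /= -{2}(mid_rev m_gt1 om E) mem_antidiag.
Qed.

(** The elimination criterion with an empty family and no variable to eliminate. *)
Lemma prime_zero N (s : seq {mpoly k[N]}) : {in s, forall q, q = 0} ->
  prime_ideal (ideal_gen s).
Proof.
move=> hs; pose g (e : void) : {mpoly k[N]} := match e with end.
apply: (@prime_ideal_span k N _ [::] g pred0).
- by move=> i; apply: tameX.
- by move=> p _ /span_nil.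
by apply: ideal_gen_span => // q /hs->; apply: span0.
Qed.

Lemma Cmx1 i j : Cmx k 1 i j = 0.
Proof. by rewrite CmxE big1 // => h; rewrite !ord1. Qed.

Lemma prime_size1 : prime_ideal (ideal_c k 1) /\ prime_ideal (ideal_a k 1).
Proof.
split; apply: prime_zero => q.
  by rewrite mem_cat => /orP[] /mapP[i _ ->]; apply: Cmx1.
by move=> /mapP[i _ ->]; apply: Cmx1.
Qed.

End Cases.
(** * The case n = 2 *)

Definition span2 (R : comNzRingType) (p q f : R) := exists s t, f = s * p + t * q.

(* The 2 x 2 minors of a 2 x 3 matrix with columns a, b, c do not form a regular
   sequence; the hypotheses say that a1, a2, [b, c] and a1, c1, b1 do. *)
Lemma minors_nzd (R : comNzRingType) (a1 a2 b1 b2 c1 c2 : R) :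
    let mab := b1 * a2 - b2 * a1 in let mbc := b1 * c2 - b2 * c1 in
    let mac := a1 * c2 - a2 * c1 in
    (forall z z', a1 * z = a1 * z' -> z = z') ->
    (forall z t, a2 * z = a1 * t -> exists t', z = a1 * t') ->
    (forall z, span2 a1 a2 (z * mbc) -> span2 a1 a2 z) ->
    (forall z t, c1 * z = a1 * t -> exists t', z = a1 * t') ->
    (forall z, span2 a1 c1 (z * b1) -> span2 a1 c1 z) ->
  forall p r s t, a1 * p = r * mab + s * mbc + t * mac ->
  exists r' s' t', p = r' * mab + s' * mbc + t' * mac.
Proof.
move=> mab mbc mac rega1 rega2 regbc regc1 regb1 p r s t E.
(* Modulo a1 and a2 the minors [mab] and [mac] vanish, so [s * mbc] lies in (a1, a2). *)
have [|s1 [s2 Es]] := regbc s.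
  exists (p + r * b2 - t * c2), (t * c1 - r * b1).
  have -> : s * mbc = a1 * p - r * mab - t * mac by rewrite E; ring.
  by rewrite /mab /mac; ring.
(* Substituting for [s] leaves an equation between a multiple of a1 and one of a2. *)
have [|u Eu] := rega2 (r * b1 - t * c1 + s2 * mbc) (p + r * b2 - t * c2 - s1 * mbc).
  have -> : a1 * (p + r * b2 - t * c2 - s1 * mbc) =
     a1 * p + a1 * (r * b2 - t * c2 - s1 * mbc) by ring.
  by rewrite E Es /mab /mac; ring.
(* Expanding [mbc] in the previous equation shows that b1 times this element lies in (a1, c1). *)
have [|r1 [r2 Er]] := regb1 (r + s2 * c2).
  exists u, (t + s2 * b2).
  have -> : u * a1 = r * b1 - t * c1 + s2 * mbc by rewrite Eu mulrC.
  by rewrite /mbc; ring.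
have [|t1 Et] := regc1 (t + s2 * b2 - b1 * r2) (b1 * r1 - u).
  have -> : a1 * (b1 * r1 - u) = a1 * (b1 * r1) - a1 * u by ring.
  rewrite -Eu; have -> : r = r1 * a1 + r2 * c1 - s2 * c2 by rewrite -Er; ring.
  by rewrite /mbc; ring.
exists r1, (s1 + r2), t1; apply: rega1; rewrite E Es.
have -> : r = r1 * a1 + r2 * c1 - s2 * c2 by rewrite -Er; ring.
have -> : t = a1 * t1 - s2 * b2 + b1 * r2 by rewrite -Et; ring.
by rewrite /mab /mbc /mac; ring.
Qed.

Section SizeTwo.
Variable k : fieldType.
Local Notation R := {mpoly k[2 * 2 + 2 * 2]}.
Local Notation o := (ord0 : 'I_2).
Local Notation l := (ord_max : 'I_2).
Local Notation x i j := ('X_(vx (i, j)) : R).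
Local Notation y i j := ('X_(vy (i, j)) : R).

Lemma ord2P (i : 'I_2) : i = o \/ i = l.
Proof. by case: i => -[|[|]] // h; [left|right]; apply: val_inj. Qed.

Lemma lift2 : lift ord0 ord0 = l. Proof. exact: val_inj. Qed.
Lemma rev2o : rev_ord o = l. Proof. exact: val_inj. Qed.
Lemma rev2l : rev_ord l = o. Proof. exact: val_inj. Qed.

Definition du : R := x o o - x l l.
Definition dv : R := y o o - y l l.

Lemma C2ol : Cmx k 2 o l = du * y o l - dv * x o l.
Proof. by rewrite CmxE big_mkcond !big_ord_recl big_ord0 lift2 /= /du /dv; ring. Qed.

Lemma C2lo : Cmx k 2 l o = dv * x l o - du * y l o.
Proof. by rewrite CmxE big_mkcond !big_ord_recl big_ord0 lift2 /= /du /dv; ring. Qed.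

Lemma C2oo : Cmx k 2 o o = x o l * y l o - y o l * x l o.
Proof. by rewrite CmxE big_mkcond !big_ord_recl big_ord0 lift2 /=; ring. Qed.

Lemma C2ll : Cmx k 2 l l = - Cmx k 2 o o.
Proof.
have := Cmx_trace k 2; rewrite !big_ord_recl big_ord0 lift2 addr0 => /eqP.
by rewrite addrC addr_eq0 => /eqP.
Qed.

(** Expansion of a 3 x 3 determinant in which the row (x_12, x_11 - x_22, x_21) occurs twice. *)
Lemma pluecker : x l o * Cmx k 2 o l + x o l * Cmx k 2 l o + du * Cmx k 2 o o = 0.
Proof. by rewrite C2ol C2lo C2oo; ring. Qed.

Lemma not_prime_a2 : ~ prime_ideal (ideal_a k 2).
Proof.
case=> _ /(_ du (Cmx k 2 o o)) h.
have ev0 (v : 'I_(2 * 2 + 2 * 2) -> k) q : (Cmx k 2 o l).@[v] = 0 ->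
    (Cmx k 2 l o).@[v] = 0 -> q \in ideal_a k 2 -> q.@[v] = 0.
  move=> h1 h2 /ideal_genP[a ->]; rewrite raddf_sum big1 // => i _ /=.
  rewrite mevalM; set c := _`_i; suff -> : c.@[v] = 0 by rewrite mulr0.
  have : c \in antidiag_entries (Cmx k 2) by apply: mem_nth.
  by case/mapP => j _ ->; case: (ord2P j) => ->; rewrite ?rev2o ?rev2l.
(* Two points where both anti-diagonal entries vanish: X = E_11, Y = 0, where [du] is 1, and X =
   E_12, Y = E_21, where c_11 is 1. *)
pose v1 i : k := (i == vx (o, o))%:R.
pose v2 i : k := ((i == vx (o, l)) || (i == vy (l, o)))%:R.
have mevalE2 v : (du.@[v] = v (vx (o, o)) - v (vx (l, l))) *
    (dv.@[v] = v (vy (o, o)) - v (vy (l, l))).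
  by rewrite /du /dv !mevalB !mevalXU.
have /orP[] : (du \in ideal_a k 2) || (Cmx k 2 o o \in ideal_a k 2).
- apply: h.
  have -> : du * Cmx k 2 o o = - (x l o * Cmx k 2 o l + x o l * Cmx k 2 l o).
    by apply/eqP; rewrite -subr_eq0 opprK addrC; apply/eqP/pluecker.
  rewrite -mulN1r; apply/ideal_genM/ideal_genD; apply: ideal_genM;
    apply: ideal_gen_mem; first by rewrite -rev2o mem_antidiag.
  by rewrite -rev2l mem_antidiag.
- move/(ev0 v1); rewrite C2ol C2lo !mevalB !mevalM !mevalE2 !mevalXU /v1.
  rewrite !eq_vx !eq_vyx /= !(subr0, mulr0, mul0r).
  by move=> /(_ erefl erefl)/eqP; rewrite oner_eq0.
move/(ev0 v2); rewrite C2ol C2lo C2oo !mevalB !mevalM !mevalE2 !mevalXU /v2.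
rewrite !eq_vx !eq_vyx !eq_vxy !eq_vy /= !(subr0, mulr0, mul0r, mulr1).
by move=> /(_ erefl erefl)/eqP; rewrite oner_eq0.
Qed.

Definition gen2 (e : 'I_2 * 'I_2) : R := Cmx k 2 e.1 e.2.
Definition labels2 := [:: (o, l); (l, o); (o, o)].

Lemma span2_labels (p q f : R) :
  span2 p q f <-> span [:: true; false] (fun b => if b then p else q) f.
Proof.
split=> [[s [t ->]]|[a ->]].
  by exists (fun b => if b then s else t); rewrite !big_cons big_nil addr0.
by exists (a true), (a false); rewrite !big_cons big_nil addr0.
Qed.

(** Chosen so that c_12, c_21, c_11, [du], [dv] have leads x_11 y_12, x_11 y_21, x_12 y_21, x_11,
    y_11. *)
Definition wx2 (a : 'I_2 * 'I_2) : nat :=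
  if a == (o, o) then 3 else if a == (o, l) then 1 else 0.
Definition wy2 (a : 'I_2 * 'I_2) : nat := if a == (o, o) then 1 else 0.
Local Notation w2 := (wt wx2 wy2).

Lemma dominant2 : [/\ dominant wx2 wy2 o l (o, true), dominant wx2 wy2 l o (o, false)
  & dominant wx2 wy2 o o (l, true)].
Proof.
by split; split=> // -[h b]; case: (ord2P h) => ->; case: b.
Qed.

Lemma w2_gt0 v : (0 < w2 v)%N. Proof. exact: wt_gt0. Qed.

Lemma lm2_du : du != 0 /\ lm w2 du = U_(vx (o, o))%MM.
Proof.
have -> : du = 1 *: 'X_[U_(vx (o, o))] + (-1) *: 'X_[U_(vx (l, l))].
  by rewrite scale1r scaleN1r.
apply: lm_eq; [exact: w2_gt0|exact: oner_neq0|].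
by apply: wlessZX; rewrite !wdegU !wt_vx.
Qed.

Lemma lm2_dv : dv != 0 /\ lm w2 dv = U_(vy (o, o))%MM.
Proof.
have -> : dv = 1 *: 'X_[U_(vy (o, o))] + (-1) *: 'X_[U_(vy (l, l))].
  by rewrite scale1r scaleN1r.
apply: lm_eq; [exact: w2_gt0|exact: oner_neq0|].
by apply: wlessZX; rewrite !wdegU !wt_vy.
Qed.

Lemma regular_var u (f z t : R) : f != 0 -> lm w2 f u = 0%N ->
  f * z = 'X_u * t -> exists t', z = 'X_u * t'.
Proof.
move=> f0 hf E.
have hl : coprime_leads w2 (fun _ : unit => 'X_u : R) (fun=> U_(u)%MM) [:: tt].
  by split=> [//|_ _|[] []//]; rewrite (lmX k w2_gt0) mpolyX_neq0.
have nz := nzd_coprime_lead w2_gt0 hl f0; have [||a ->] := nz _ z.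
- by move=> _ _ v; rewrite mnm1E; case: eqP => [<-|_]; [right|left].
- by exists (fun=> t); rewrite big_seq1 E mulrC.
by exists (a tt); rewrite big_seq1 mulrC.
Qed.

Lemma regular_vars u v (f z : R) : u != v -> f != 0 ->
  lm w2 f u = 0%N -> lm w2 f v = 0%N -> span2 'X_u 'X_v (z * f) -> span2 'X_u 'X_v z.
Proof.
move=> uv f0 hu hv /span2_labels; rewrite mulrC => hz; apply/span2_labels.
pose mu (b : bool) := (if b then U_(u) else U_(v))%MM : 'X_{1..2 * 2 + 2 * 2}.
have hl : coprime_leads w2 (fun b : bool => if b then 'X_u else 'X_v : R) mu
    [:: true; false].
  split=> // [[] _|b b' _ _ ne i]; rewrite ?(lmX k w2_gt0) ?mpolyX_neq0 //.
  have hi : U_(u)%MM i = 0%N \/ U_(v)%MM i = 0%N.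
    rewrite !mnm1E; have [<-|_] := eqVneq u i; last by left.
    by right; rewrite eq_sym (negbTE uv).
  by move: ne; case: b; case: b' => //= _; case: hi; by [left|right].
apply: (nzd_coprime_lead w2_gt0 hl f0 _ hz) => b _ i; rewrite /mu.
by case: b; rewrite mnm1E; case: eqP => [<-|_]; by [right|left].
Qed.

Lemma span_labels2 p : span labels2 gen2 p <-> exists r s t,
  p = r * Cmx k 2 o l + s * Cmx k 2 l o + t * Cmx k 2 o o.
Proof.
split=> [[a ->]|[r [s [t ->]]]].
  exists (a (o, l)), (a (l, o)), (a (o, o)).
  by rewrite !big_cons big_nil addr0 addrA.
by apply: spanD; [apply: spanD|]; apply: spanM;
  [apply: (span_gen gen2 (e := (o, l)))|apply: (span_gen gen2 (e := (l, o)))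
  |apply: (span_gen gen2 (e := (o, o)))].
Qed.

Lemma lm2_Clo : Cmx k 2 l o != 0 /\ lm w2 (Cmx k 2 l o) = cmon (o, o) (l, o).
Proof. by case: dominant2 => _ h _; apply: (Cmx_lead k h). Qed.

Lemma cmon_eq0 (a b : 'I_2 * 'I_2) v : v != vx a -> v != vy b -> cmon a b v = 0%N.
Proof. by rewrite mnmDE !mnm1E ![_ == v]eq_sym => /negbTE-> /negbTE->. Qed.

(** The columns are (x_12, y_12), (du, dv), (x_21, y_21); the minor of the last two is -c_21, whence
    the sign of [s]. Leading monomials give the required regular sequences. *)
Lemma nzd2_x : nzd labels2 gen2 (x o l).
Proof.
have [Cn0 lmC] := lm2_Clo; have [u0 lmu] := lm2_du; have [v0 lmv] := lm2_dv.
move=> p /span_labels2[r [s [t E]]].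
have [||||||r' [s' [t' Ep]]] :=
  @minors_nzd R (x o l) (y o l) du dv (x l o) (y l o) _ _ _ _ _ p r (- s) t.
- exact/mulfI/mpolyX_neq0.
- move=> z z0; apply: regular_var; first exact: mpolyX_neq0.
  by rewrite (lmX k w2_gt0) mnm1E eq_vyx.
- move=> z; have -> : du * y l o - dv * x l o = - Cmx k 2 l o by rewrite C2lo; ring.
  apply: regular_vars; rewrite ?eq_vxy ?oppr_eq0 ?lmN ?lmC //; apply: cmon_eq0;
    by rewrite ?eq_vx ?eq_vy ?eq_vxy ?eq_vyx.
- move=> z z0; apply: regular_var; first exact: mpolyX_neq0.
  by rewrite (lmX k w2_gt0) mnm1E eq_vx.
- move=> z; apply: regular_vars; rewrite ?eq_vx ?lmu ?mnm1E ?eq_vx //.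
- by rewrite E C2ol C2lo C2oo; ring.
apply/span_labels2; exists r', (- s'), t'; rewrite Ep C2ol C2lo C2oo; ring.
Qed.

(** Interchanging x and y changes the sign of every minor. *)
Lemma nzd2_y : nzd labels2 gen2 (y o l).
Proof.
have [Cn0 lmC] := lm2_Clo; have [u0 lmu] := lm2_du; have [v0 lmv] := lm2_dv.
move=> p /span_labels2[r [s [t E]]].
have [||||||r' [s' [t' Ep]]] :=
  @minors_nzd R (y o l) (x o l) dv du (y l o) (x l o) _ _ _ _ _ p (- r) s (- t).
- exact/mulfI/mpolyX_neq0.
- move=> z z0; apply: regular_var; first exact: mpolyX_neq0.
  by rewrite (lmX k w2_gt0) mnm1E eq_vxy.
- move=> z; have -> : dv * x l o - du * y l o = Cmx k 2 l o by rewrite C2lo; ring.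
  apply: regular_vars; rewrite ?eq_vyx ?lmC //; apply: cmon_eq0;
    by rewrite ?eq_vx ?eq_vy ?eq_vxy ?eq_vyx.
- move=> z z0; apply: regular_var; first exact: mpolyX_neq0.
  by rewrite (lmX k w2_gt0) mnm1E eq_vy.
- move=> z; apply: regular_vars; rewrite ?eq_vy ?lmv ?mnm1E ?eq_vy //.
- by rewrite E C2ol C2lo C2oo; ring.
apply/span_labels2; exists (- r'), s', (- t'); rewrite Ep C2ol C2lo C2oo; ring.
Qed.

(** x_11 is solved from c_12 with pivot y_12, and y_21 from c_11 with pivot x_12. *)
Definition elim2 v := (v == vx (o, o)) || (v == vy (l, o)).

(** The leads of c_12 and c_21 share x_11. After multiplication by x_12, which is not eliminated,
    the relation [pluecker] removes c_21; the leads of c_12 and c_11 are coprime, and each involves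
    an eliminated variable. *)
Lemma span_avoids2 p : avoids elim2 p -> span labels2 gen2 p -> p = 0.
Proof.
move=> ap /span_labels2[r [s [t E]]].
pose g b := gen2 (if b then (o, l) else (o, o)).
pose mu b := if b then cmon (o, o) (o, l) else cmon (o, l) (l, o) : 'X_{1..2 * 2 + 2 * 2}.
have hl : coprime_leads w2 g mu [:: true; false].
  have [d1 _ d2] := dominant2; split=> // [[] _|b b' _ _ ne].
  - exact: Cmx_lead d1.
  - exact: Cmx_lead d2.
  have h := @cmon_disjoint 2 (o, o) (o, l) (o, l) (l, o) isT isT.
  by move: ne; case: b; case: b' => //= _ v; case: (h v); by [left|right].
have sp : span [:: true; false] g (x o l * p).
  exists (fun b => if b then x o l * r - s * x l o else x o l * t - s * du).
  rewrite !big_cons big_nil addr0 /g /gen2 /= E.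
  have -> : x o l * (r * Cmx k 2 o l + s * Cmx k 2 l o + t * Cmx k 2 o o) =
    x o l * r * Cmx k 2 o l + x o l * t * Cmx k 2 o o
    + s * (x o l * Cmx k 2 l o) by ring.
  have -> : x o l * Cmx k 2 l o = - (x l o * Cmx k 2 o l + du * Cmx k 2 o o).
    by apply/eqP; rewrite -subr_eq0 opprK addrC addrAC; apply/eqP/pluecker.
  by ring.
have x0 : x o l != 0 by apply: mpolyX_neq0.
apply/eqP; apply: contraT => p0; have xp0 : x o l * p != 0 by rewrite mulf_neq0.
have [b _ /mnm_lepP le] := lm_span w2_gt0 hl sp xp0.
have axp : avoids elim2 (x o l * p).
  by apply: avoidsM => //; apply: avoidsX; rewrite /elim2 eq_vx eq_vxy.
have := axp _ (lm_supp w2_gt0 xp0).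
case: b le => le h.
  have := le (vx (o, o)); rewrite h /elim2 ?eqxx //.
  by rewrite mnmDE !mnm1E eqxx.
have := le (vy (l, o)); rewrite h /elim2 ?eqxx ?orbT //.
by rewrite mnmDE !mnm1E eqxx addn1.
Qed.

Lemma tame2 v : tame labels2 gen2 elim2 'X_v.
Proof.
have tX u : ~~ elim2 u -> tame labels2 gen2 elim2 'X_u by apply: tameX.
have [E|h1] := eqVneq v (vx (o, o)).
  have e1 : tame labels2 gen2 elim2 (x l l * y o l + dv * x o l).
    rewrite /dv; apply: tameD; apply: tameM; try apply: tameB;
    by apply: tX; rewrite /elim2 ?eq_vx ?eq_vxy ?eq_vyx ?eq_vy.
  apply: (tame_div nzd2_y _ e1).
    by apply: tX; rewrite /elim2 eq_vyx eq_vy.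
  have -> : y o l * 'X_v - (x l l * y o l + dv * x o l) = gen2 (o, l).
    by rewrite E /gen2 C2ol /du; ring.
  exact: span_gen.
have [E|h2] := eqVneq v (vy (l, o)); last by apply: tX; rewrite /elim2 negb_or h1.
have e1 : tame labels2 gen2 elim2 (y o l * x l o).
  by apply: tameM; apply: tX; rewrite /elim2 ?eq_vx ?eq_vxy ?eq_vyx ?eq_vy.
apply: (tame_div nzd2_x _ e1).
  by apply: tX; rewrite /elim2 eq_vx eq_vxy.
have -> : x o l * 'X_v - y o l * x l o = gen2 (o, o) by rewrite E /gen2 C2oo.
exact: span_gen.
Qed.

Lemma prime_c2 : prime_ideal (ideal_c k 2).
Proof.
apply: (prime_ideal_span tame2 span_avoids2).
have hoo : span labels2 gen2 (Cmx k 2 o o) by apply: (span_gen gen2 (e := (o, o))).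
apply: ideal_gen_span => [q|e].
  rewrite mem_cat => /orP[] /mapP[i _ ->]; case: (ord2P i) => ->; rewrite ?C2ll //.
  - exact: spanN.
  - by rewrite rev2o; apply: (span_gen gen2 (e := (o, l))).
  by rewrite rev2l; apply: (span_gen gen2 (e := (l, o))).
rewrite !inE mem_cat => /or3P[] /eqP->; last by rewrite mem_diag.
  by rewrite /gen2 /= -rev2o mem_antidiag orbT.
by rewrite /gen2 /= -rev2l mem_antidiag orbT.
Qed.

End SizeTwo.

(** * Primality in the cases n = 1, n = 2 and n >= 3 together *)

Theorem corollary1p4 (k : fieldType) (n : nat) (hn : (1 <= n)%N) :
  prime_ideal (ideal_c k n) /\ (prime_ideal (ideal_a k n) <-> n <> 2%N).
Proof.
case: n hn => [//|[|[|m]]] _.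
- by have [hc ha] := prime_size1 k.
- by split; [apply: prime_c2|split=> // /not_prime_a2].
- by split; [apply: prime_c|split=> // _; apply: prime_a].
Qed.
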